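(* Let $n\ge2$, let $X_1,\dots,X_n$ be i.i.d. positive random variables with density $f$, where $f$ is regularly varying at $\infty$ with index $-\alpha-1$ for some $\alpha>0$, and let $\overline F(x)=P(X_1>x)$. For $b>0$ let $p_b=P(S_n>b)$ with $S_n=X_1+\dots+X_n$. Consider the conditional mixture algorithm (described in the context) with $p_i=\frac{n-i}{n-i+1}$, $q_i=1-p_i$ for $1\le i\le n-1$, and with parameter $a=a_b\in(0,1)$ depending on $b$ such that $1-a_b$ is of exact order $b^{-\frac1{2(n-1)}+\delta}$ as $b\to\infty$ for some $0<\delta<\frac1{2(n-1)}$ (that is, there are constants $0<c_1\le c_2<\infty$ with $c_1 b^{-\frac1{2(n-1)}+\delta}\le 1-a_b\le c_2 b^{-\frac1{2(n-1)}+\delta}$ for all sufficiently large $b$). Let $\hat p_b$ be the corresponding (single-replication) importance sampling estimator of $p_b$. Then the algorithm has asymptotically optimal relative error for computing $p_b$, i.e. $$\lim_{b\to\infty}\frac{E\,\hat p_b^{\,2}}{p_b^2}=1 .$$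
   Context: Regular variation of $f$ with index $-\alpha-1$: $\lim_{u\to\infty} f(ux)/f(u)=x^{-\alpha-1}$ for each $x>0$. Conditional mixture algorithm with parameter $a\in(0,1)$ and threshold $b>0$: for $s\le b$ put $$g_i(x\mid s)=\frac{f(x)I\{x>a(b-s)\}}{\overline F(a(b-s))}\quad(1\le i\le n-1),\qquad g_n(x\mid s)=\frac{f(x)I\{x>b-s\}}{\overline F(b-s)}.$$ The vector $(X_1,\dots,X_n)$ is generated sequentially, with $S_0=0$ and $S_i=X_1+\dots+X_i$: given $S_{i-1}=s_{i-1}$, the variable $X_i$ is sampled from the density - $f$, if $s_{i-1}>b$; - $p_i f(\cdot)+q_i g_i(\cdot\mid s_{i-1})$, if $s_{i-1}\le b$ and $1\le i\le n-1$; - $g_n(\cdot\mid s_{n-1})$, if $s_{n-1}\le b$ and $i=n$. Denote this conditional density by $k_i(\cdot\mid s_{i-1})$ and the resulting law on $\mathbb R^n$ by $\nu_n^b$; let $\mu_n$ be the original law, with density $\prod_i f(x_i)$. The estimator is $\hat p_b=\frac{d\mu_n}{d\nu_n^b}(X_1,\dots,X_n)\,I\{S_n>b\}$ with $(X_1,\dots,X_n)\sim\nu_n^b$, where $\frac{d\mu_n}{d\nu_n^b}(x)=\prod_{i=1}^n\frac{f(x_i)}{k_i(x_i\mid x_1+\dots+x_{i-1})}$ on $\{x_1+\dots+x_n>b\}$ (with $0/0=0$; only this set matters), and $E\hat p_b^{\,2}$ is its second moment under $\nu_n^b$; equivalently $E\hat p_b^{\,2}=\int_{\{x_1+\dots+x_n>b\}}\frac{d\mu_n}{d\nu_n^b}\,d\mu_n$.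 *)

(* Defs.v *)
From HB Require Import structures.
From mathcomp Require Import all_boot all_order all_algebra.
From mathcomp Require Import all_classical all_reals all_analysis.
From mathcomp Require Import measurable_realfun.

Set Implicit Arguments.
Unset Strict Implicit.
Unset Printing Implicit Defensive.

Import Order.TTheory GRing.Theory Num.Theory.
Import numFieldNormedType.Exports.
Import KCOMP_FINITE_KERNEL.

Local Open Scope classical_set_scope.
Local Open Scope ring_scope.

Definition regularly_varying (R : realType) (f : R -> R) (rho : R) : Prop :=
  forall x : R, 0 < x -> f (u * x) / f u @[u --> +oo] --> x `^ rho.

Record density (R : realType) := Density {
  dens :> R -> R;
  measurable_dens : measurable_fun [set: R] dens;
  dens_ge0 : forall x, 0 <= dens x;
  integral_dens : (\int[lebesgue_measure]_x (dens x)%:E = 1)%E }.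

Definition has_density d (T : measurableType d) (R : realType)
    (P : probability T R) (X : {RV P >-> R}) (f : density R) : Prop :=
  forall A : set R, measurable A ->
    distribution P X A = (\int[lebesgue_measure]_(x in A) (f x)%:E)%E.

Definition mutually_independent d (T : measurableType d) (R : realType)
    (P : probability T R) (n : nat) (X : 'I_n -> {RV P >-> R}) : Prop :=
  forall (J : {set 'I_n}) (A : 'I_n -> set R), (forall i, measurable (A i)) ->
    P (\bigcap_(i in [set` J]) (X i @^-1` A i)) =
    (\prod_(i in J) P (X i @^-1` A i))%E.

Section conditional_mixture.
Context {R : realType}.
Variables (f : density R) (n : nat) (a b : R).

Local Notation leb := (@lebesgue_measure R).

(* P(X_1 > t) when X_1 has density f. *)
Definition tail (t : R) : R := fine (\int[leb]_(x in `]t, +oo[) (f x)%:E).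

Definition cond_tail_density (t x : R) : R :=
  (if t < x then f x else 0) / tail t.

(* Steps are numbered from 1 to n; p_i is only used for i < n. *)
Definition mix_p (i : nat) : R := (n - i)%:R / (n - i + 1)%:R.

Definition mix_q (i : nat) : R := 1 - mix_p i.

(* The density k_i of X_i given S_(i-1) = s. *)
Definition cm_density (i : nat) (s x : R) : R :=
  if b < s then f x
  else if (i < n)%N then
    mix_p i * f x + mix_q i * cond_tail_density (a * (b - s)) x
  else cond_tail_density (b - s) x.

Lemma tail_ge0 t : 0 <= tail t.
Proof.
by apply: fine_ge0; apply: integral_ge0 => x _; rewrite lee_fin dens_ge0.
Qed.

Lemma cond_tail_density_ge0 t x : 0 <= cond_tail_density t x.
Proof.
by rewrite divr_ge0 ?tail_ge0//; case: ifP => // _; exact: dens_ge0.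
Qed.

Lemma mix_p_ge0 i : 0 <= mix_p i.
Proof. by rewrite divr_ge0. Qed.

Lemma mix_p_le1 i : mix_p i <= 1.
Proof.
by rewrite /mix_p addn1 ler_pdivrMr ?ltr0n// mul1r ler_nat leqnSn.
Qed.

Lemma mix_q_ge0 i : 0 <= mix_q i.
Proof. by rewrite subr_ge0 mix_p_le1. Qed.

Lemma cm_density_ge0 i s x : 0 <= cm_density i s x.
Proof.
rewrite /cm_density; case: ifP => _; first exact: dens_ge0.
case: ifP => _; last exact: cond_tail_density_ge0.
apply: addr_ge0; apply: mulr_ge0.
- exact: mix_p_ge0.
- exact: dens_ge0.
- exact: mix_q_ge0.
- exact: cond_tail_density_ge0.
Qed.

Lemma measurable_gt_dens :
  measurable_fun [set: R * R] (fun z : R * R => if z.1 < z.2 then f z.2 else 0).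
Proof.
apply: measurable_fun_ifT => //.
  exact: measurable_fun_ltr.
exact: measurableT_comp (measurable_dens f) _.
Qed.

Lemma tailE t :
  tail t = fine (\int[leb]_x (if t < x then f x else 0)%:E).
Proof.
rewrite /tail integral_mkcond; congr fine; apply: eq_integral => x _.
rewrite patchE; case: ifPn => [|/negP] ; rewrite inE/= in_itv/= andbT.
  by move=> ->.
by move=> /negP/negbTE ->.
Qed.

Lemma measurable_tail : measurable_fun [set: R] tail.
Proof.
rewrite (_ : tail = fine \o
  (fun t => \int[leb]_x (if t < x then f x else 0)%:E)%E); last first.
  by apply/funext => t /=; exact: tailE.
apply: measurableT_comp => //.
apply: (@measurable_fun_fubini_tonelli_F _ _ _ _ _ leb
  (fun z : R * R => (if z.1 < z.2 then f z.2 else 0)%:E)).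
  by apply/measurable_EFinP; exact: measurable_gt_dens.
by move=> z; rewrite lee_fin; case: ifP => // _; exact: dens_ge0.
Qed.

Lemma measurable_cond_tail_density (h : R -> R) :
  measurable_fun [set: R] h ->
  measurable_fun [set: R * R]
    (fun z : R * R => cond_tail_density (h z.1) z.2).
Proof.
move=> mh; apply: measurable_funM.
  apply: measurable_fun_ifT => //.
    by apply: measurable_fun_ltr => //; exact: measurableT_comp.
  exact: measurableT_comp (measurable_dens f) _.
rewrite (_ : (fun _ => _) = (fun u : R => u `^ (-1)) \o tail \o h \o fst).
  apply: measurableT_comp => //; apply: measurableT_comp => //.
  by apply: measurableT_comp; [exact: measurable_powR|exact: measurable_tail].
by apply/funext => z /=; rewrite powR_inv1// tail_ge0.
Qed.

Lemma measurable_cm_density i :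
  measurable_fun [set: R * R] (fun z : R * R => cm_density i z.1 z.2).
Proof.
have mf2 : measurable_fun [set: R * R] (fun z : R * R => f z.2).
  exact: measurableT_comp (measurable_dens f) _.
rewrite /cm_density; apply: measurable_fun_ifT => //.
  exact: measurable_fun_ltr.
case: (i < n)%N.
  apply: measurable_funD; apply: measurable_funM => //.
  apply: (measurable_cond_tail_density (h := fun s => a * (b - s))).
  by apply: measurable_funM => //; exact: measurable_funB.
apply: (measurable_cond_tail_density (h := fun s => b - s)).
exact: measurable_funB.
Qed.

Lemma tail_fin_num t :
  (\int[leb]_x (if t < x then f x else 0)%:E \is a fin_num)%E.
Proof.
rewrite ge0_fin_numE; last first.
  by apply: integral_ge0 => x _; rewrite lee_fin; case: ifP => // _;
    exact: dens_ge0.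
apply: (@le_lt_trans _ _ (\int[leb]_x (f x)%:E)%E); last first.
  by rewrite integral_dens ltry.
apply: ge0_le_integral => //.
- by move=> x _; rewrite lee_fin; case: ifP => // _; exact: dens_ge0.
- apply/measurable_EFinP.
  exact: (measurableT_comp measurable_gt_dens (pair1_measurable t)).
- by apply/measurable_EFinP; exact: measurable_dens.
- by move=> x _; rewrite lee_fin; case: ifP => // _; exact: dens_ge0.
Qed.

Lemma integral_cond_tail_density t :
  (\int[leb]_x (cond_tail_density t x)%:E = (tail t / tail t)%:E)%E.
Proof.
rewrite /cond_tail_density.
under eq_integral do rewrite EFinM.
rewrite ge0_integralZr//.
- by rewrite -(fineK (tail_fin_num t)) -tailE -EFinM.
- apply/measurable_EFinP.
  exact: (measurableT_comp measurable_gt_dens (pair1_measurable t)).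
- by move=> x _; rewrite lee_fin; case: ifP => // _; exact: dens_ge0.
- by rewrite lee_fin invr_ge0 tail_ge0.
Qed.

Lemma measurable_cm_density2 i s : measurable_fun [set: R] (cm_density i s).
Proof.
exact: (measurableT_comp (measurable_cm_density i) (pair1_measurable s)).
Qed.

Lemma integral_cm_density i s :
  (\int[leb]_x (cm_density i s x)%:E =
   (if b < s then 1
    else if (i < n)%N then
      mix_p i + mix_q i * (tail (a * (b - s)) / tail (a * (b - s)))
    else tail (b - s) / tail (b - s))%:E)%E.
Proof.
have mc t : measurable_fun [set: R] (cond_tail_density t).
  apply: (measurableT_comp (measurable_cond_tail_density (h := cst t) _)
    (pair1_measurable t)).
  exact: measurable_cst.
rewrite /cm_density; case: (b < s); first by rewrite integral_dens.
case: (i < n)%N; last exact: integral_cond_tail_density.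
under eq_integral do rewrite EFinD.
rewrite ge0_integralD//=; last 4 first.
- by move=> x _; rewrite lee_fin mulr_ge0// ?mix_p_ge0 ?dens_ge0.
- by apply/measurable_EFinP; apply: measurable_funM => //;
    exact: measurable_dens.
- by move=> x _; rewrite lee_fin mulr_ge0// ?mix_q_ge0 ?cond_tail_density_ge0.
- by apply/measurable_EFinP; apply: measurable_funM => //; exact: mc.
under eq_integral do rewrite EFinM.
rewrite ge0_integralZl//; last 3 first.
- by apply/measurable_EFinP; exact: measurable_dens.
- by move=> x _; rewrite lee_fin dens_ge0.
- by rewrite lee_fin mix_p_ge0.
rewrite integral_dens mule1.
under eq_integral do rewrite EFinM.
rewrite ge0_integralZl//; last 3 first.
- by apply/measurable_EFinP; exact: mc.
- by move=> x _; rewrite lee_fin cond_tail_density_ge0.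
- by rewrite lee_fin mix_q_ge0.
by rewrite integral_cond_tail_density -EFinM -EFinD.
Qed.

Lemma integral_cm_density_le1 i s :
  (\int[leb]_x (cm_density i s x)%:E <= 1)%E.
Proof.
have le1 t : tail t / tail t <= 1.
  by have [->|t0] := eqVneq (tail t) 0; [rewrite mul0r|rewrite divff].
rewrite integral_cm_density lee_fin; case: ifP => // _; case: ifP => // _.
rewrite -[leRHS](subrK (mix_p i)) addrC -/(mix_q i) lerD2r.
by rewrite ler_piMr// mix_q_ge0.
Qed.

Lemma integral_cm_density_eq1 i s : (forall t, 0 < tail t) ->
  (\int[leb]_x (cm_density i s x)%:E = 1)%E.
Proof.
move=> tail0; rewrite integral_cm_density !divff ?gt_eqF//.
by rewrite mulr1 /mix_q addrC subrK !if_same.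
Qed.

Definition cm_step (i : nat) (s : R) (A : set R) : \bar R :=
  (\int[leb]_(x in A) (cm_density i s x)%:E)%E.

Section cm_step_measure.
Variables (i : nat) (s : R).

Let cm_step0 : cm_step i s set0 = 0%E.
Proof. by rewrite /cm_step integral_set0. Qed.

Let cm_step_ge0 A : (0 <= cm_step i s A)%E.
Proof. by apply: integral_ge0 => x _; rewrite lee_fin cm_density_ge0. Qed.

Let cm_step_sigma_additive : semi_sigma_additive (cm_step i s).
Proof.
move=> /= A mA tA mUA; rewrite /cm_step; apply: cvg_toP.
  apply: ereal_nondecreasing_is_cvgn => m k mk.
  by apply: lee_sum_nneg_natr => // j _ _; exact: cm_step_ge0.
rewrite ge0_integral_bigcup//=.
- by apply/measurable_funTS/measurable_EFinP; exact: measurable_cm_density2.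
- by move=> x _; rewrite lee_fin cm_density_ge0.
Qed.

HB.instance Definition _ := isMeasure.Build _ _ _
  (cm_step i s) cm_step0 cm_step_ge0 cm_step_sigma_additive.

End cm_step_measure.

Definition cm_kernel (i : nat) : R -> {measure set R -> \bar R} := cm_step i.

Section cm_kernel_kernel.
Variable i : nat.

Let measurable_cm_kernel U : measurable U ->
  measurable_fun [set: R] (cm_kernel i ^~ U).
Proof.
move=> mU.
rewrite (_ : (fun _ => _) = (fun s =>
    \int[leb]_x (cm_density i s x * \1_U x)%:E)%E); last first.
  apply/funext => s; rewrite /cm_kernel/= /cm_step integral_mkcond.
  apply: eq_integral => x _; rewrite patchE indicE.
  by case: ifP => _; rewrite ?mulr1 ?mulr0.
apply: (@measurable_fun_fubini_tonelli_F _ _ _ _ _ leb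
  (fun z : R * R => (cm_density i z.1 z.2 * \1_U z.2)%:E)).
  apply/measurable_EFinP; apply: measurable_funM.
    exact: measurable_cm_density.
  exact: measurableT_comp (measurable_indic mU) _.
by move=> z; rewrite lee_fin mulr_ge0// cm_density_ge0.
Qed.

HB.instance Definition _ :=
  isKernel.Build _ _ R R R (cm_kernel i) measurable_cm_kernel.

Let cm_kernel_uub : measure_fam_uub (cm_kernel i).
Proof.
exists 2 => s; apply: (@le_lt_trans _ _ 1%E).
  exact: integral_cm_density_le1.
by rewrite lte_fin ltr1n.
Qed.

HB.instance Definition _ :=
  Kernel_isFinite.Build _ _ R R R (cm_kernel i) cm_kernel_uub.

End cm_kernel_kernel.

Section cons_kernel.
Variables (m : nat) (k : R.-fker R ~> (m.-tuple R)).

Definition tuple_cons (x : R) (t : m.-tuple R) : m.+1.-tuple R :=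
  [tuple of x :: t].

Lemma measurable_tuple_cons :
  measurable_fun [set: R * m.-tuple R]
    (fun z : R * m.-tuple R => tuple_cons z.1 z.2).
Proof. exact: measurable_cons. Qed.

Lemma measurable_tuple_cons2 x : measurable_fun [set: m.-tuple R] (tuple_cons x).
Proof.
exact: (measurableT_comp measurable_tuple_cons (pair1_measurable x)).
Qed.

(* For z = (s, x): the law of x :: t, with t drawn from k started at the
   updated sum s + x. *)
Definition cons_law (z : R * R) (A : set (m.+1.-tuple R)) : \bar R :=
  k (z.1 + z.2) (tuple_cons z.2 @^-1` A).

Section cons_law_measure.
Variable z : R * R.

Let cons_law0 : cons_law z set0 = 0%E.
Proof. by rewrite /cons_law preimage_set0 measure0. Qed.

Let cons_law_ge0 A : (0 <= cons_law z A)%E.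
Proof. exact: measure_ge0. Qed.

Let measurable_pre A : measurable A -> measurable (tuple_cons z.2 @^-1` A).
Proof.
by move=> mA; rewrite -[X in measurable X]setTI; exact: measurable_tuple_cons2.
Qed.

Let cons_law_sigma_additive : semi_sigma_additive (cons_law z).
Proof.
move=> F mF tF mUF; rewrite /cons_law preimage_bigcup.
apply: measure_semi_sigma_additive.
- by move=> j; exact: measurable_pre.
- apply/trivIsetP => /= i j _ _ ij; rewrite -preimage_setI.
  by move/trivIsetP : tF => /(_ _ _ _ _ ij) ->//; rewrite preimage_set0.
- by rewrite -preimage_bigcup; exact: measurable_pre.
Qed.

HB.instance Definition _ := isMeasure.Build _ _ _
  (cons_law z) cons_law0 cons_law_ge0 cons_law_sigma_additive.

End cons_law_measure.

Definition cons_kernel : R * R -> {measure set (m.+1.-tuple R) -> \bar R} :=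
  cons_law.

Definition add_kernel (z : R * R) : {measure set (m.-tuple R) -> \bar R} :=
  k (z.1 + z.2).

Let measurable_add_kernel U : measurable U ->
  measurable_fun [set: R * R] (add_kernel ^~ U).
Proof.
move=> mU; apply: (measurableT_comp (measurable_kernel k U mU)).
exact: measurable_funD.
Qed.

HB.instance Definition _ :=
  isKernel.Build _ _ _ _ R add_kernel measurable_add_kernel.

Let add_kernel_uub : measure_fam_uub add_kernel.
Proof. by have [r kr] := measure_uub k; exists r => z; exact: kr. Qed.

HB.instance Definition _ :=
  Kernel_isFinite.Build _ _ _ _ R add_kernel add_kernel_uub.

Let measurable_cons_kernel U : measurable U ->
  measurable_fun [set: R * R] (cons_kernel ^~ U).
Proof.
move=> mU.
pose A := (fun w : (R * R) * m.-tuple R => tuple_cons w.1.2 w.2) @^-1` U.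
rewrite (_ : (fun _ => _) = (fun z => add_kernel z (xsection A z))); last first.
  by apply/funext => z; rewrite xsectionE.
apply: measurable_fun_xsection_finite_kernel; rewrite inE.
rewrite -[X in measurable X]setTI.
apply: (measurable_cons (f := fun w : (R * R) * m.-tuple R => w.1.2)
  (g := snd)) => //.
exact: measurableT_comp.
Qed.

HB.instance Definition _ :=
  isKernel.Build _ _ _ _ R cons_kernel measurable_cons_kernel.

Let cons_kernel_uub : measure_fam_uub cons_kernel.
Proof. by have [r kr] := measure_uub k; exists r => z; exact: kr. Qed.

HB.instance Definition _ :=
  Kernel_isFinite.Build _ _ _ _ R cons_kernel cons_kernel_uub.

End cons_kernel.

Definition nil_kernel : R -> {measure set (0.-tuple R) -> \bar R} :=
  kdirac (@measurable_cst _ _ R _ setT ([tuple] : 0.-tuple R)).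

HB.instance Definition _ := FiniteKernel.on nil_kernel.

(* s |-> the law of (X_i, ..., X_(i+m-1)) given S_(i-1) = s. *)
Fixpoint cm_tail_kernel (m i : nat) : R.-fker R ~> (m.-tuple R) :=
  match m with
  | 0 => nil_kernel
  | m'.+1 => (cm_kernel i \; cons_kernel (cm_tail_kernel m' i.+1))%E
  end.

(* Division by 0 yields 0, so that this is only a sub-probability measure if
   the tail of f vanishes somewhere; otherwise see cm_law_setT. *)
Definition cm_law : {measure set (n.-tuple R) -> \bar R} :=
  cm_tail_kernel n 1 0.

Lemma cm_law_setT : (forall t, 0 < tail t) -> cm_law setT = 1%E.
Proof.
move=> tail0; rewrite /cm_law.
suff H : forall m i s, cm_tail_kernel m i s setT = 1%E by exact: H.
elim=> [|m ih] i s /=; first by rewrite /nil_kernel/= diracT.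
rewrite /kcomp (eq_integral (cst 1%E)); last first.
  by move=> x _; rewrite /cons_kernel/= /cons_law preimage_setT ih.
rewrite integral_cst// mul1e.
exact: integral_cm_density_eq1.
Qed.

Definition partial_sum (t : n.-tuple R) (i : nat) : R :=
  \sum_(j < n | (j < i)%N) tnth t j.

(* The likelihood ratio on {partial_sum t n > b}, with 0 / 0 = 0. The index i is
   0-based here: tnth t i is x_(i+1), sampled given S_i = partial_sum t i. *)
Definition cm_ratio (t : n.-tuple R) : R :=
  \prod_(i < n) (f (tnth t i) / cm_density i.+1 (partial_sum t i) (tnth t i)).

Definition cm_estimator (t : n.-tuple R) : R :=
  cm_ratio t * \1_[set u | b < partial_sum u n] t.

End conditional_mixture.

(* Main.v *)
(* The second moment of the estimator obeys a backward recursion W_m(s) in the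
   number m of remaining steps and the current sum s, with W_m(s) <= 1 when
   s > b. Write F for the tail of f and r = b - s for the remaining distance.
   By induction on m, limsup W_m(s) / F(b)^2 <= m^2 for r close to b, since a
   step of size x falls into one of four ranges:
   - x <= (1 - rho) r, with rho < 1 close to 1: the remaining distance is still
     close to b, and the likelihood ratio is at most (m + 1) / m, so that the
     contribution is about (m + 1) m F(b)^2;
   - (1 - rho) r < x <= a r: this has probability at most F(const * b), and all
     later remaining distances are at least (1 - a)^(n - 1) const * b, so that
     the contribution is at most of order F(b) F((1 - a)^(n - 1) const * b)^2;
     the order of 1 - a makes the last factor exceed the scale sqrt b, and
     Potter-type bounds on F show that this is o(F(b)^2);
   - a r < x <= r: this contributes o(F(b)^2) because a tends to 1;
   - x > r: the likelihood ratio is about (m + 1) F(r), and the contribution is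
     about (m + 1) F(b)^2.
   Hence E Z^2 <= (n^2 + o(1)) F(b)^2, whereas P(S_n > b) >= (n + o(1)) F(b) by
   considering the largest step, and E Z^2 >= (E Z)^2 = P(S_n > b)^2. *)
Require Import Defs.
From mathcomp Require Import all_boot all_order all_algebra.
From mathcomp Require Import all_classical all_reals all_analysis.
From mathcomp Require Import measurable_realfun ring lra.

Import Order.TTheory GRing.Theory Num.Theory.
Import numFieldNormedType.Exports.

Local Open Scope classical_set_scope.
Local Open Scope ring_scope.

(** * Lebesgue integrals *)

Section integral_density.
Local Open Scope ereal_scope.
Context {d : measure_display} {T : measurableType d} {R : realType}.
Variables (mu nu : {measure set T -> \bar R}) (g : T -> R).
Hypotheses (mg : measurable_fun setT g) (g0 : forall x, (0 <= g x)%R)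
  (nuE : forall A, measurable A -> nu A = \int[mu]_(x in A) (g x)%:E).

Import HBNNSimple.

Let mgE : measurable_fun setT (EFin \o g).
Proof. exact/measurable_EFinP. Qed.

(** Simple functions come first: linearity over their level sets reduces the claim to [nuE].
    Monotone convergence along [nnsfun_approx] then gives [ge0_integral_density]. *)
Let integral_density_nnsfun (h : {nnsfun T >-> R}) :
  \int[nu]_x (h x)%:E = \int[mu]_x ((g x)%:E * (h x)%:E).
Proof.
transitivity (\int[nu]_x
   (\sum_(y \in range h) (y * \1_(h @^-1` [set y]) x)%:E)).
  by apply: eq_integral => t _; rewrite /= fimfunE -fsumEFin.
have indich r : measurable_fun setT (fun x => (r * \1_(h @^-1` [set r]) x)%:E).
  by apply: (measurable_comp measurableT) => //; exact: measurable_funM.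
rewrite ge0_integral_fsum//; last first.
  by move=> m y Ey; rewrite EFinM nnfun_muleindic_ge0.
transitivity (\int[mu]_x (\sum_(y \in range h)
    (g x)%:E * (y * \1_(h @^-1` [set y]) x)%:E)); last first.
  apply: eq_integral => x _; rewrite -ge0_mule_fsumr => [|y]; last first.
    by rewrite EFinM nnfun_muleindic_ge0.
  by rewrite fsumEFin // -(fimfunE _ x).
rewrite ge0_integral_fsum//; last 2 first.
  - by move=> y; exact: emeasurable_funM.
  - by move=> m y Ey; rewrite mule_ge0 ?lee_fin// -lee_fin EFinM nnfun_muleindic_ge0.
apply: eq_fsbigr => r rhn.
under [LHS]eq_integral do rewrite EFinM.
rewrite integralZl_indic_nnsfun => //.
under [RHS]eq_integral do rewrite EFinM muleCA.
rewrite ge0_integralZl//.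
- rewrite [in RHS](eq_integral ((EFin \o g) \_ (h @^-1` [set r]))); last first.
    by move=> x xE; rewrite epatch_indic.
  by rewrite -integral_mkcondr setTI -nuE// integral_indic// setIT.
- by apply: emeasurable_funM => //; exact/measurable_EFinP.
- by move=> t _; rewrite mule_ge0 ?lee_fin.
- by move: rhn; rewrite inE => -[t _ <-]; rewrite lee_fin.
Qed.

Lemma ge0_integral_density (h : T -> \bar R) :
  measurable_fun setT h -> (forall x, 0 <= h x) ->
  \int[nu]_x h x = \int[mu]_x ((g x)%:E * h x).
Proof.
move=> mh h0; pose h_ := nnsfun_approx measurableT mh.
have hE x : h x = lim ((h_ n x)%:E @[n --> \oo]).
  by apply/esym/cvg_lim => //; exact: cvg_nnsfun_approx.
have ghE x : (g x)%:E * h x = lim ((g x)%:E * (h_ n x)%:E @[n --> \oo]).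
  by apply/esym/cvg_lim => //; apply: cvgeZl => //; exact: cvg_nnsfun_approx.
under eq_integral do rewrite hE.
under [RHS]eq_integral do rewrite ghE.
rewrite !monotone_convergence//.
- by under eq_fun do rewrite integral_density_nnsfun.
- by move=> n; apply: emeasurable_funM => //; exact/measurable_EFinP.
- by move=> n x _; rewrite mule_ge0 ?lee_fin.
- move=> x _ a b ab; rewrite lee_wpmul2l ?lee_fin//.
  exact/lefP/nd_nnsfun_approx.
- by move=> n; exact/measurable_EFinP.
- by move=> n x _; rewrite lee_fin.
- by move=> x _ a b ab; rewrite lee_fin; exact/lefP/nd_nnsfun_approx.
Qed.

End integral_density.

(* R and measurableTypeR R carry the same measurable sets but different
   displays, so that a measure on R and lebesgue_measure do not have the same
   type: the identity transports one to the other. *)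
Lemma ge0_integral_lebesgue_density (R : realType) (nu : {measure set R -> \bar R})
    (g : R -> R) (h : R -> \bar R) :
  measurable_fun setT g -> (forall x, 0 <= g x) ->
  (forall A, measurable A ->
    nu A = (\int[lebesgue_measure]_(x in A) (g x)%:E)%E) ->
  measurable_fun setT h -> (forall x, 0 <= h x)%E ->
  (\int[nu]_x h x = \int[lebesgue_measure]_x ((g x)%:E * h x))%E.
Proof.
move=> mg g0 nuE mh h0.
have mid : measurable_fun [set: measurableTypeR R] (idfun : measurableTypeR R -> R).
  exact: measurable_id.
pose mu : {measure set R -> \bar R} :=
  measure_function_pushforward__canonical__measure_function_Measure
    lebesgue_measure mid.
have muE A (k : R -> \bar R) : measurable A -> measurable_fun A k ->
    (forall x, 0 <= k x)%E ->
    (\int[mu]_(x in A) k x = \int[lebesgue_measure]_(x in A) k x)%E.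
  by move=> mA mk k0; rewrite ge0_integral_pushforward.
have mgE : measurable_fun setT (EFin \o g) by exact/measurable_EFinP.
rewrite (ge0_integral_density mu _ g)//.
- rewrite muE//; first exact: emeasurable_funM.
  by move=> x; rewrite mule_ge0 ?lee_fin.
- move=> A mA; rewrite nuE// muE//; first exact: measurable_funTS.
Qed.

Section lebesgue_scaling.
Context {R : realType}.
Local Notation leb := (@lebesgue_measure R).

Let image_measure (c : R) : {measure set (measurableTypeR R) -> \bar R} :=
  @measure_function_pushforward__canonical__measure_function_Measure _ _
    (measurableTypeR R) (measurableTypeR R) R leb ( *%R c) (mulrl_measurable c).

(** The image of Lebesgue measure under dilation by [c], multiplied by [c], agrees with Lebesgue
    measure on half-open intervals, and these determine it. *)
Lemma lebesgue_measure_scale (c : R) (A : set R) : 0 < c -> measurable A ->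
  leb A = (c%:E * leb (( *%R c) @^-1` A))%E.
Proof.
move=> c0 mA; pose cn : {nonneg R} := NngNum (ltW c0).
rewrite -[RHS]/(mscale cn (image_measure c) A).
apply: lebesgue_measure_unique => //.
move=> _ [[x y] /= _ <-]; rewrite /mscale /= /pushforward /=.
have -> : ( *%R c : R -> R) @^-1` `]x, y] = `](x / c), (y / c)]%classic.
  apply/seteqP; split => z /=; rewrite !in_itv/=;
  by rewrite ltr_pdivrMr// ler_pdivlMr// (mulrC c).
rewrite !lebesgue_measure_itv/= !lte_fin ltr_pM2r ?invr_gt0//.
case: ifPn => _; last by rewrite mule0.
by rewrite -!EFinB -EFinM; congr EFin; field; rewrite gt_eqF.
Qed.

Lemma ge0_integral_scale (c : R) (h : R -> \bar R) : 0 < c ->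
  measurable_fun setT h -> (forall x, (0 <= h x)%E) ->
  (\int[leb]_x h x = c%:E * \int[leb]_x h (c * x)%R)%E.
Proof.
move=> c0 mh h0; pose cn : {nonneg R} := NngNum (ltW c0).
transitivity (\int[mscale cn (image_measure c)]_x h x)%E.
  by apply: eq_measure_integral => A mA _; exact: lebesgue_measure_scale.
rewrite ge0_integral_mscale//; congr (_ * _)%E.
by rewrite ge0_integral_pushforward//; exact: mulrl_measurable.
Qed.

End lebesgue_scaling.

(** * Integrals against the sampling kernel *)

Definition above {R : realType} (b s : R) : R := \1_[set u | b < u] s.

(* The integral over x_i, ..., x_(i+m-1) of the product of the g_j(s_(j-1), x_j)
   over the event that the final sum, started at s, exceeds b. *)
Fixpoint sum_chain {R : realType} (g : nat -> R -> R -> R) (b : R)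
    (m i : nat) (s : R) : \bar R :=
  match m with
  | 0 => (above b s)%:E
  | m'.+1 =>
    (\int[lebesgue_measure]_x ((g i s x)%:E * sum_chain g b m' i.+1 (s + x)))%E
  end.

Section sum_chain.
Context {R : realType}.
Implicit Types (g : nat -> R -> R -> R) (b s : R).

Lemma above_ge0 b s : 0 <= above b s.
Proof. by rewrite /above indicE. Qed.

Lemma above_le1 b s : above b s <= 1.
Proof. by rewrite /above indicE; case: (_ \in _). Qed.

Lemma above1 b s : b < s -> above b s = 1.
Proof. by move=> bs; rewrite /above indicE mem_set. Qed.

Lemma above0 b s : s <= b -> above b s = 0.
Proof.
by move=> sb; rewrite /above indicE memNset//= => bs; move: sb; rewrite leNgt bs.
Qed.

Lemma measurable_above b : measurable_fun setT (above b).
Proof.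
apply: measurable_indic.
rewrite (_ : [set u | _] = `]b, +oo[%classic)//.
by apply/seteqP; split => u /=; rewrite in_itv/= andbT.
Qed.

Lemma sum_chain_ge0 g b m i s : (forall j s x, 0 <= g j s x) ->
  (0 <= sum_chain g b m i s)%E.
Proof.
move=> g0; elim: m i s => [|m ih] i s /=; first by rewrite lee_fin above_ge0.
by apply: integral_ge0 => x _; rewrite mule_ge0// lee_fin.
Qed.

Lemma measurable_sum_chain g b m i : (forall j s x, 0 <= g j s x) ->
  (forall j, measurable_fun [set: R * R] (fun z => g j z.1 z.2)) ->
  measurable_fun setT (sum_chain g b m i).
Proof.
move=> g0 mg; elim: m i => [|m ih] i /=.
  by apply/measurable_EFinP; exact: measurable_above.
apply: (measurable_fun_fubini_tonelli_F (m2 := lebesgue_measure)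
  (fun z : R * R => (g i z.1 z.2)%:E * sum_chain g b m i.+1 (z.1 + z.2)%R)%E).
  apply: emeasurable_funM; first by apply/measurable_EFinP; exact: mg.
  apply: (measurableT_comp (ih i.+1) (g := fun z : R * R => z.1 + z.2)).
  exact: measurable_funD.
by move=> z; rewrite mule_ge0 ?lee_fin// sum_chain_ge0.
Qed.

End sum_chain.

Section path_weight.
Context {R : realType}.
Implicit Types (w : nat -> R -> R -> R) (b s : R).

(** The starting index [i] and the starting sum [s] are parameters so that removing the first
    coordinate stays within the family, as in [path_weight_cons]. Positive powers of the estimator
    are instances with [i = 1] and [s = 0]. *)
Definition path_weight w b m i s (t : m.-tuple R) : R :=
  (\prod_(j < m) w (i + j)%N (s + partial_sum t j) (tnth t j)) *
  above b (s + partial_sum t m).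

Lemma partial_sum0 m (t : m.-tuple R) : partial_sum t 0 = 0.
Proof. by rewrite /partial_sum big_pred0. Qed.

Lemma partial_sum_cons m x (t : m.-tuple R) i :
  partial_sum (tuple_cons x t) i.+1 = x + partial_sum t i.
Proof.
rewrite /partial_sum big_mkcond big_ord_recl/= [X in _ = _ + X]big_mkcond.
by congr (_ + _); apply: eq_bigr => j _; rewrite tnthS.
Qed.

Lemma path_weight_cons w b m i s x (t : m.-tuple R) :
  path_weight w b m.+1 i s (tuple_cons x t) =
  w i s x * path_weight w b m i.+1 (s + x) t.
Proof.
rewrite /path_weight big_ord_recl/= addn0 partial_sum0 addr0 mulrA.
rewrite partial_sum_cons addrA; congr (_ * _ * _).
by apply: eq_bigr => j _; rewrite tnthS /= partial_sum_cons addrA /bump/= add1n addnS.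
Qed.

Lemma path_weight_ge0 w b m i s (t : m.-tuple R) :
  (forall j s x, 0 <= w j s x) -> 0 <= path_weight w b m i s t.
Proof. by move=> w0; rewrite mulr_ge0 ?above_ge0// prodr_ge0. Qed.

Lemma measurable_partial_sum m i :
  measurable_fun setT (fun t : m.-tuple R => partial_sum t i).
Proof.
under eq_fun do rewrite /partial_sum big_mkcond.
apply: measurable_sum => j; case: (j < i)%N => //.
exact: measurable_tnth.
Qed.

Lemma measurable_path_weight w b m i s :
  (forall j, measurable_fun [set: R * R] (fun z => w j z.1 z.2)) ->
  measurable_fun setT (@path_weight w b m i s).
Proof.
move=> mw; apply: measurable_funM.
  apply: measurable_prod => j _.
  apply: (measurableT_comp (mw (i + j)%N)
    (g := fun t : m.-tuple R => (s + partial_sum t j, tnth t j))).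
  apply: measurable_fun_pair; last exact: measurable_tnth.
  by apply: measurable_funD => //; exact: measurable_partial_sum.
apply: (measurableT_comp (measurable_above b)).
by apply: measurable_funD => //; exact: measurable_partial_sum.
Qed.

Lemma integral_cm_kernel (f : density R) n a b i s (h : R -> \bar R) :
  measurable_fun setT h -> (forall x, 0 <= h x)%E ->
  (\int[cm_kernel f n a b i s]_x h x =
   \int[lebesgue_measure]_x ((cm_density f n a b i s x)%:E * h x))%E.
Proof.
move=> mh h0.
apply: ge0_integral_lebesgue_density => //.
- exact: measurable_cm_density2.
- by move=> x; exact: cm_density_ge0.
Qed.

(** Turns moments under the sampling law into iterated Lebesgue integrals. By induction the first
    coordinate is split off: [cm_kernel] has density [cm_density], and the other coordinates follow
    the same kernel restarted at [s + x]. *)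
Lemma integral_cm_tail_kernel (f : density R) n a b w m i s :
  (forall j s x, 0 <= w j s x) ->
  (forall j, measurable_fun [set: R * R] (fun z => w j z.1 z.2)) ->
  (\int[cm_tail_kernel f n a b m i s]_t (path_weight w b m i s t)%:E =
   sum_chain (fun j s x => (cm_density f n a b j s x * w j s x)%R) b m i s)%E.
Proof.
move=> w0 mw.
elim: m i s => [|m ih] i s.
  rewrite /= integral_dirac//; last first.
    by apply/measurable_EFinP; exact: measurable_path_weight.
  by rewrite diracT mul1e /path_weight big_ord0 mul1r partial_sum0 addr0.
have mP k j u : measurable_fun setT (EFin \o @path_weight w b k j u).
  by apply/measurable_EFinP; exact: measurable_path_weight.
rewrite /= integral_kcomp; last 2 first.
- by move=> t; rewrite lee_fin path_weight_ge0.
- exact: mP.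
transitivity (\int[cm_kernel f n a b i s]_x
    \int[cons_kernel (cm_tail_kernel f n a b m i.+1) (s, x)]_t
      (path_weight w b m.+1 i s t)%:E)%E => //.
rewrite integral_cm_kernel.
- apply: eq_integral => x _.
  rewrite EFinM -muleA; congr (_ * _)%E; rewrite -ih -ge0_integralZl//; last 2 first.
  + by move=> t _; rewrite lee_fin path_weight_ge0.
  + by rewrite lee_fin.
  (* By definition, [cons_kernel] at [(s, x)] is the image under [tuple_cons x] of the tail kernel
     started at [s + x]. *)
  transitivity (\int[pushforward (cm_tail_kernel f n a b m i.+1 (s + x)%R)
      (tuple_cons x)]_t (path_weight w b m.+1 i s t)%:E)%E => //.
  rewrite ge0_integral_pushforward//.
  + by apply: eq_integral => t _ /=; rewrite path_weight_cons EFinM.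
  + exact: measurable_tuple_cons2.
  + exact: mP.
  + by move=> t _; rewrite lee_fin path_weight_ge0.
  + exact: mP.
- apply: (measurable_fun_integral_kernel
    (l := fun x => cons_kernel (cm_tail_kernel f n a b m i.+1) (s, x))) => //.
    move=> U mU; exact: (measurableT_comp
      (measurable_kernel (cons_kernel (cm_tail_kernel f n a b m i.+1)) U mU)
      (pair1_measurable s)).
    by move=> t; rewrite lee_fin path_weight_ge0.
  exact: mP.
- by move=> x; apply: integral_ge0 => t _; rewrite lee_fin path_weight_ge0.
Qed.

End path_weight.

(** * One step of the second moment *)

Lemma ge0_integral_itv_split (R : realType) (x y z : itv_bound R) (h : R -> \bar R) :
  (x <= y)%O -> (y <= z)%O -> measurable_fun setT h -> (forall u, 0 <= h u)%E ->
  (\int[lebesgue_measure]_(u in [set` Interval x z]) h u =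
   \int[lebesgue_measure]_(u in [set` Interval x y]) h u +
   \int[lebesgue_measure]_(u in [set` Interval y z]) h u)%E.
Proof.
move=> xy yz mh h0; rewrite (itv_bndbnd_setU xy yz) ge0_integral_setU//.
  exact: measurable_funTS.
rewrite disj_set2E; apply/eqP/seteqP; split => // u [] /=.
rewrite !itv_boundlr => /andP[_ uy] /andP[yu _].
by have := le_trans uy yu; rewrite bnd_simp ltxx.
Qed.

Section tail.
Context {R : realType} (f : density R).
Local Notation leb := (@lebesgue_measure R).

Lemma measurable_densE : measurable_fun setT (EFin \o f).
Proof. by apply/measurable_EFinP; exact: measurable_dens. Qed.

Lemma densE_ge0 x : (0 <= (f x)%:E)%E.
Proof. by rewrite lee_fin dens_ge0. Qed.

Lemma tailK t : (tail f t)%:E = (\int[leb]_(x in `]t, +oo[) (f x)%:E)%E.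
Proof.
rewrite /tail fineK// ge0_fin_numE; last first.
  by apply: integral_ge0 => x _; exact: densE_ge0.
apply: (@le_lt_trans _ _ (\int[leb]_x (f x)%:E)%E); last first.
  by rewrite integral_dens ltry.
apply: ge0_subset_integral => //; first exact: measurable_densE.
by move=> x _; exact: densE_ge0.
Qed.

Lemma tail_itv t u : t <= u ->
  (\int[leb]_(x in `]t, u]) (f x)%:E = (tail f t - tail f u)%:E)%E.
Proof.
move=> tu; rewrite EFinB !tailK.
rewrite [X in _ = (X - _)%E](@ge0_integral_itv_split _ _ (BRight u))//.
- by rewrite -tailK addeK.
- exact: measurable_densE.
- exact: densE_ge0.
Qed.

Lemma tail_head t :
  (\int[leb]_(x in `]-oo, t]) (f x)%:E = (1 - tail f t)%:E)%E.
Proof.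
rewrite EFinB tailK -(integral_dens f) -set_itvNyy.
rewrite [X in _ = (X - _)%E](@ge0_integral_itv_split _ _ (BRight t))//.
- by rewrite -tailK addeK.
- exact: measurable_densE.
- exact: densE_ge0.
Qed.

Lemma le_tail t u : t <= u -> tail f u <= tail f t.
Proof.
move=> tu; rewrite -subr_ge0 -lee_fin -tail_itv//.
by apply: integral_ge0 => x _; exact: densE_ge0.
Qed.

Lemma tail_le1 t : tail f t <= 1.
Proof.
rewrite -subr_ge0 -lee_fin -tail_head.
by apply: integral_ge0 => x _; exact: densE_ge0.
Qed.

Lemma measurable_dens_mul (h : R -> \bar R) :
  measurable_fun setT h -> measurable_fun setT (fun x => (f x)%:E * h x)%E.
Proof. by move=> mh; apply: emeasurable_funM => //; exact: measurable_densE. Qed.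

Lemma integral_dens_le (D : set R) (h : R -> \bar R) (c : \bar R) :
  measurable D -> measurable_fun setT h -> (forall x, 0 <= h x)%E -> (0 <= c)%E ->
  (forall x, D x -> h x <= c)%E ->
  (\int[leb]_(x in D) ((f x)%:E * h x) <=
   c * \int[leb]_(x in D) (f x)%:E)%E.
Proof.
move=> mD mh h0 c0 hc; rewrite -ge0_integralZl//; last 2 first.
- by apply: measurable_funTS; exact: measurable_densE.
- by move=> x _; exact: densE_ge0.
apply: ge0_le_integral => //.
- by move=> x _; rewrite mule_ge0// densE_ge0.
- by apply: measurable_funTS; exact: measurable_dens_mul.
- apply: measurable_funTS; apply: measurable_funeM; exact: measurable_densE.
- by move=> x Dx; rewrite muleC lee_pmul ?densE_ge0// hc.
Qed.

Lemma integral_dens_le1 (D : set R) (h : R -> \bar R) (c : \bar R) :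
  measurable D -> measurable_fun setT h -> (forall x, 0 <= h x)%E -> (0 <= c)%E ->
  (forall x, D x -> h x <= c)%E ->
  (\int[leb]_(x in D) ((f x)%:E * h x) <= c)%E.
Proof.
move=> mD mh h0 c0 hc; apply: (le_trans (integral_dens_le _ _ _ mD mh h0 c0 hc)).
rewrite -[leRHS]mule1 lee_wpmul2l// -(integral_dens f).
apply: ge0_subset_integral => //; first exact: measurable_densE.
by move=> x _; exact: densE_ge0.
Qed.

Hypothesis f_pos : (\int[leb]_(x in `]-oo, 0%R]) (f x)%:E = 0)%E.

Lemma tail0 : tail f 0 = 1.
Proof.
by move: f_pos; rewrite tail_head => -[] /eqP; rewrite subr_eq0 => /eqP.
Qed.

Lemma integral_dens_pos (h : R -> \bar R) :
  measurable_fun setT h -> (forall x, 0 <= h x)%E ->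
  (\int[leb]_x ((f x)%:E * h x) = \int[leb]_(x in `]0%R, +oo[) ((f x)%:E * h x))%E.
Proof.
move=> mh h0; rewrite -set_itvNyy.
rewrite (@ge0_integral_itv_split _ _ (BRight 0))//; last 2 first.
- exact: measurable_dens_mul.
- by move=> x; rewrite mule_ge0// densE_ge0.
rewrite [X in (X + _)%E](_ : _ = 0%E) ?add0e//.
apply/eqP; rewrite eq_le integral_ge0 ?andbT; last first.
  by move=> x _; rewrite mule_ge0// densE_ge0.
(* The crude bound of [h] by [+oo] suffices, since [f] has integral 0 on this half-line and
   [+oo * 0 = 0]. *)
rewrite -(mule0 +oo%E) -f_pos; apply: integral_dens_le => // x _.
exact: leey.
Qed.

End tail.

Section second_moment.
Context {R : realType} (f : density R) (n : nat).
Local Notation leb := (@lebesgue_measure R).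
Implicit Types a b s x : R.

Hypothesis f_pos : (\int[leb]_(x in `]-oo, 0%R]) (f x)%:E = 0)%E.
Hypothesis tail_gt0 : forall t, 0 < tail f t.

Definition cm_ratio1 a b i s x : R := f x / cm_density f n a b i s x.

Lemma cm_ratio1_ge0 a b i s x : 0 <= cm_ratio1 a b i s x.
Proof. by rewrite divr_ge0 ?dens_ge0 ?cm_density_ge0. Qed.

Lemma measurable_cm_ratio1 a b i :
  measurable_fun [set: R * R] (fun z => cm_ratio1 a b i z.1 z.2).
Proof.
apply: measurable_funM.
  exact: measurableT_comp (measurable_dens f) _.
(* For nonnegative [u], including [u = 0], the inverse is the power of [u] with exponent [-1], a
   measurable function. *)
rewrite (_ : (fun _ => _) = (fun u : R => u `^ (-1)) \o
    (fun z : R * R => cm_density f n a b i z.1 z.2)); last first.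
  by apply/funext => z /=; rewrite powR_inv1// cm_density_ge0.
by apply: measurableT_comp; [exact: measurable_powR|exact: measurable_cm_density].
Qed.

Lemma measurable_cm_density_ratio1 k a b i : measurable_fun [set: R * R]
  (fun z => cm_density f n a b i z.1 z.2 * cm_ratio1 a b i z.1 z.2 ^+ k).
Proof.
apply: measurable_funM; first exact: measurable_cm_density.
by apply: measurable_funX; exact: measurable_cm_ratio1.
Qed.

(* With m steps to go the next one has index n + 1 - m. *)
Definition second_moment a b m s : \bar R :=
  sum_chain (fun j s x => cm_density f n a b j s x * cm_ratio1 a b j s x ^+ 2)
    b m (n.+1 - m) s.

Lemma cm_density_ratio1_ge0 k a b i s x :
  0 <= cm_density f n a b i s x * cm_ratio1 a b i s x ^+ k.
Proof. by rewrite mulr_ge0 ?cm_density_ge0// exprn_ge0// cm_ratio1_ge0. Qed.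

Lemma second_moment_ge0 a b m s : (0 <= second_moment a b m s)%E.
Proof. by apply: sum_chain_ge0 => j t x; exact: cm_density_ratio1_ge0. Qed.

Lemma measurable_second_moment a b m : measurable_fun setT (second_moment a b m).
Proof.
apply: measurable_sum_chain => *; [exact: cm_density_ratio1_ge0|].
exact: measurable_cm_density_ratio1.
Qed.

Lemma measurable_second_momentD a b m s :
  measurable_fun setT (fun x => second_moment a b m (s + x)).
Proof.
apply: (measurableT_comp (measurable_second_moment a b m) (g := fun x => s + x)).
exact: measurable_funD.
Qed.

Lemma second_momentS a b m s : (m < n.+1)%N -> second_moment a b m.+1 s =
  (\int[leb]_x ((cm_density f n a b (n - m)%N s x *
     cm_ratio1 a b (n - m)%N s x ^+ 2)%:E * second_moment a b m (s + x)%R))%E.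
Proof. by rewrite ltnS => mn; rewrite /second_moment /= subSS -subSn. Qed.

Let measurable_step a b i s m D : measurable_fun D (fun x =>
  (cm_density f n a b i s x * cm_ratio1 a b i s x ^+ 2)%:E *
  second_moment a b m (s + x)%R)%E.
Proof.
apply: measurable_funTS; apply: emeasurable_funM; last first.
  exact: measurable_second_momentD.
apply/measurable_EFinP.
exact: (measurableT_comp (measurable_cm_density_ratio1 2 a b i)
  (pair1_measurable s)).
Qed.

(** With [k] the sampling density, one factor of the ratio turns [k] into at most [f], since
    [k * (f / k)] is [f], or 0 when [k = 0]. The other factor is bounded by [c]; where [f] vanishes
    the ratio is 0, so no bound is asked there. *)
Let step_le a b i s m (c : R) D : measurable D -> 0 <= c ->
  (forall x, D x -> f x != 0 -> cm_ratio1 a b i s x <= c) ->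
  (\int[leb]_(x in D) ((cm_density f n a b i s x * cm_ratio1 a b i s x ^+ 2)%:E *
     second_moment a b m (s + x)%R) <=
   c%:E * \int[leb]_(x in D) ((f x)%:E * second_moment a b m (s + x)%R))%E.
Proof.
move=> mD c0 rc; rewrite -ge0_integralZl//; last 2 first.
- apply: measurable_funTS; apply: measurable_dens_mul.
  exact: measurable_second_momentD.
- by move=> x _; rewrite mule_ge0 ?densE_ge0// second_moment_ge0.
apply: ge0_le_integral => //.
- by move=> x _; rewrite mule_ge0 ?second_moment_ge0// lee_fin cm_density_ratio1_ge0.
- exact: measurable_step.
- apply: measurable_funTS; apply: measurable_funeM; apply: measurable_dens_mul.
  exact: measurable_second_momentD.
move=> x Dx; rewrite muleA lee_wpmul2r ?second_moment_ge0// -EFinM lee_fin.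
have [fx0|fx0] := eqVneq (f x) 0.
  by rewrite /cm_ratio1 fx0 mul0r expr0n/= !mulr0.
rewrite expr2 mulrA mulrC ler_pM ?cm_ratio1_ge0//.
- by rewrite mulr_ge0 ?cm_density_ge0 ?cm_ratio1_ge0.
- exact: rc.
rewrite /cm_ratio1 mulrCA; have [->|k0] := eqVneq (cm_density f n a b i s x) 0.
  by rewrite mul0r mulr0 dens_ge0.
by rewrite divff// mulr1.
Qed.

(** Beyond [b] every step is sampled from [f] itself, with ratio at most 1, and by [f_pos] the steps
    are almost surely positive, so the sum stays beyond [b]. *)
Lemma second_moment_above a b m s : (m <= n)%N -> b < s ->
  (second_moment a b m s <= 1)%E.
Proof.
elim: m s => [|m ih] s mn bs; first by rewrite /second_moment/= lee_fin above_le1.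
rewrite second_momentS; last exact: leqW.
apply: (le_trans (step_le _ _ _ _ _ 1 setT _ _ _)) => //.
  by move=> x _ fx0; rewrite /cm_ratio1 /cm_density bs divff.
rewrite mul1e integral_dens_pos//; last 2 first.
- exact: measurable_second_momentD.
- by move=> x; exact: second_moment_ge0.
apply: integral_dens_le1 => //.
- exact: measurable_second_momentD.
- by move=> x; exact: second_moment_ge0.
move=> x /=; rewrite in_itv/= andbT => x0; apply: ih; first exact: ltnW.
by rewrite ltr_wpDr// ltW.
Qed.

(** The last step is sampled conditionally on exceeding [b - s]. There the ratio is the constant
    [tail f (b - s)], and the mass of [f] on this range gives the second factor. *)
Lemma second_moment1 a b s : (0 < n)%N -> s <= b ->
  (second_moment a b 1 s <= (tail f (b - s) ^+ 2)%:E)%E.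
Proof.
move=> n0 sb; have bsF : b < s = false by rewrite ltNge sb.
rewrite second_momentS// subn0 -set_itvNyy.
rewrite (@ge0_integral_itv_split _ _ (BRight (b - s)))//; last first.
  by move=> x; rewrite mule_ge0 ?second_moment_ge0// lee_fin cm_density_ratio1_ge0.
rewrite [X in (X + _)%E](_ : _ = 0%E) ?add0e; last first.
  apply: integral0_eq => x /=; rewrite in_itv/= => xbs.
  rewrite /cm_density bsF ltnn /cond_tail_density ltNge xbs/=.
  by rewrite !mul0r mul0e.
apply: (le_trans (step_le _ _ _ _ _ (tail f (b - s)) _ _ _ _)) => //.
- exact: tail_ge0.
- move=> x /=; rewrite in_itv/= andbT => bsx fx0.
  rewrite /cm_ratio1 /cm_density bsF ltnn /cond_tail_density bsx.
  by rewrite invf_div mulrCA divff// mulr1.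
rewrite expr2 EFinM lee_wpmul2l ?lee_fin ?tail_ge0// tailK.
rewrite -[leRHS]mul1e; apply: integral_dens_le => //.
- exact: measurable_second_momentD.
- by move=> x; exact: second_moment_ge0.
- move=> x _; rewrite /second_moment /= lee_fin; exact: above_le1.
Qed.

(** At index [n - m] the mixture weights are [m / (m + 1)] and [1 / (m + 1)]. Keeping only the
    component [f] bounds the ratio by [(m + 1) / m], which serves below [t]; keeping only the
    conditional component bounds it by [(m + 1) * tail f t] above [t]. *)
Lemma second_moment_step a b m s : (0 < m < n)%N -> s <= b ->
  let t := a * (b - s) in
  (second_moment a b m.+1 s <=
   (m.+1%:R / m%:R)%:E *
     \int[leb]_(x in `]-oo, t]) ((f x)%:E * second_moment a b m (s + x)%R) +
   (m.+1%:R * tail f t)%:E *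
     \int[leb]_(x in `]t, +oo[) ((f x)%:E * second_moment a b m (s + x)%R))%E.
Proof.
move=> /andP[m0 mn] sb /=; set t := a * (b - s).
have bsF : b < s = false by rewrite ltNge sb.
have nm : (n - m < n)%N by rewrite ltn_subrL m0 (leq_ltn_trans _ mn).
have pE : mix_p n (n - m) = m%:R / m.+1%:R :> R.
  by rewrite /mix_p subKn 1?ltnW// addn1.
have qE : mix_q n (n - m) = m.+1%:R^-1 :> R.
  rewrite /mix_q pE -[X in X - _](@divff _ m.+1%:R) ?pnatr_eq0// -mulrBl.
  by rewrite -natrB// subSnn mul1r.
have m0' : 0 < m%:R :> R by rewrite ltr0n.
have m1' : 0 < m.+1%:R :> R by rewrite ltr0n.
rewrite second_momentS; last by rewrite ltnS ltnW.
rewrite -set_itvNyy (@ge0_integral_itv_split _ _ (BRight t))//; last first.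
  by move=> x; rewrite mule_ge0 ?second_moment_ge0// lee_fin cm_density_ratio1_ge0.
have kge x y : 0 < y -> y <= cm_density f n a b (n - m) s x ->
    cm_ratio1 a b (n - m) s x <= f x / y.
  move=> y0 yk; rewrite ler_wpM2l ?dens_ge0// lef_pV2// posrE.
  exact: lt_le_trans yk.
have f0 x : f x != 0 -> 0 < f x by rewrite lt0r dens_ge0 andbT.
have kE x : cm_density f n a b (n - m) s x =
    m%:R / m.+1%:R * f x + m.+1%:R^-1 * cond_tail_density f t x.
  by rewrite /cm_density bsF nm pE qE.
apply: leeD; apply: step_le => //.
- move=> x _ fx0; apply: le_trans (kge x (m%:R / m.+1%:R * f x) _ _) _.
  + by rewrite !mulr_gt0 ?invr_gt0 ?f0.
  + by rewrite kE lerDl mulr_ge0 ?invr_ge0 ?cond_tail_density_ge0.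
  + by rewrite invfM invf_div mulrCA divff// mulr1.
- by rewrite mulr_ge0 ?tail_ge0.
- move=> x /=; rewrite in_itv/= andbT => tx fx0.
  apply: le_trans (kge x (m.+1%:R^-1 * (f x / tail f t)) _ _) _.
  + by rewrite !mulr_gt0 ?invr_gt0 ?f0.
  + by rewrite kE /cond_tail_density tx lerDr !mulr_ge0 ?invr_ge0 ?dens_ge0.
  + by rewrite !invfM !invrK mulrCA (mulrA (f x)) divff// mul1r.
Qed.

End second_moment.

(** * Crude and sharp bounds on the second moment *)

Section crude_bound.
Context {R : realType} (f : density R) (n : nat).
Local Notation leb := (@lebesgue_measure R).

Hypothesis f_pos : (\int[leb]_(x in `]-oo, 0%R]) (f x)%:E = 0)%E.
Hypothesis tail_gt0 : forall t, 0 < tail f t.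

(** The factorial solves the recursion met in [second_moment_crude]: passing from [m] to [m + 1]
    remaining steps costs the factor [2 + (m + 1)]. *)
Definition crude_const (m : nat) : R := (m.+2)`!%:R.

Lemma crude_const_ge1 m : 1 <= crude_const m.
Proof. by rewrite ler1n fact_gt0. Qed.

Lemma crude_const_ge0 m : 0 <= crude_const m.
Proof. exact: le_trans (crude_const_ge1 m). Qed.

Let mD a b m s := measurable_second_momentD f n a b m s.

Let ge0 a b m s := second_moment_ge0 f n a b m s.

Lemma natrS_div_le2 m : (0 < m)%N -> m.+1%:R / m%:R <= 2 :> R.
Proof.
move=> m0; rewrite ler_pdivrMr ?ltr0n// -natrM ler_nat mul2n -addnn.
by rewrite -addn1 leq_add2l.
Qed.

(** A step of size at most [a * (b - s)] leaves at least the fraction [1 - a] of the distance, so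
    each of the [m - 1] steps before the last contributes one factor [1 - a]. A larger step costs
    [tail f (a * (b - s))] twice, once in the ratio and once as probability; as [1 - a <= a], this
    is absorbed by the same bound. *)
Lemma second_moment_crude a b m s : (0 < m <= n)%N -> 2^-1 <= a < 1 -> s <= b ->
  (second_moment f n a b m s <=
   (crude_const m * tail f ((1 - a) ^+ m.-1 * (b - s)) ^+ 2)%:E)%E.
Proof.
move=> + /andP[a2 a1]; case: m => // m.
elim: m s => [|m ih] s /= mn sb.
  rewrite expr0 mul1r; apply: (le_trans (second_moment1 _ _ _ _ _ _ _)) => //.
  by rewrite lee_fin ler_peMl ?sqr_ge0// crude_const_ge1.
have mn' : (m < n)%N by exact: ltnW.
have bounded x : (second_moment f n a b m.+1 x <= (crude_const m.+1)%:E)%E.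
  have [xb|bx] := leP x b; last first.
    by apply: (le_trans (second_moment_above _ _ f_pos _ _ _ _ _ _)) => //;
      rewrite lee_fin crude_const_ge1.
  apply: (le_trans (ih _ _ _)) => //.
  by rewrite lee_fin ler_piMr ?crude_const_ge0// exprn_ile1 ?tail_ge0 ?tail_le1.
apply: (le_trans (second_moment_step _ _ tail_gt0 _ _ _ _ _ _)) => //.
set t := a * (b - s); set Tm := tail f (_ ^+ _ * _); set K := crude_const m.+1.
have r0 : 0 <= b - s by rewrite subr_ge0.
have a'0 : 0 <= 1 - a by rewrite subr_ge0 ltW.
have K0 : 0 <= K by exact: crude_const_ge0.
have tT : tail f t <= Tm.
  apply: le_tail; apply: ler_wpM2r => //.
  apply: (@le_trans _ _ (1 - a)); last by lra.
  rewrite -[leRHS]expr1; apply: ler_wiXn2l => //; lra.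
have I1 : (\int[leb]_(x in `]-oo, t])
    ((f x)%:E * second_moment f n a b m.+1 (s + x)%R) <= (K * Tm ^+ 2)%:E)%E.
  apply: integral_dens_le1 => //.
  - by rewrite lee_fin mulr_ge0// sqr_ge0.
  move=> x /=; rewrite in_itv/= => xt.
  have xr : (1 - a) * (b - s) <= b - (s + x) by rewrite /t in xt; lra.
  have /(ih _ mn') : s + x <= b.
    by rewrite -subr_ge0; apply: le_trans xr; exact: mulr_ge0.
  move=> /le_trans; apply; rewrite lee_fin ler_wpM2l// lerXn2r ?nnegrE ?tail_ge0//.
  by apply: le_tail; rewrite exprSr -mulrA ler_wpM2l// exprn_ge0.
have I2 : (\int[leb]_(x in `]t, +oo[)
    ((f x)%:E * second_moment f n a b m.+1 (s + x)%R) <= (K * tail f t)%:E)%E.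
  by rewrite EFinM tailK; apply: integral_dens_le.
have c0 : 0 <= m.+2%:R / m.+1%:R :> R by rewrite divr_ge0.
apply: (le_trans (leeD (lee_wpmul2l _ I1) (lee_wpmul2l _ I2))) => //.
  by rewrite lee_fin mulr_ge0// tail_ge0.
rewrite -!EFinM -EFinD lee_fin.
apply: (@le_trans _ _ (2 * (K * Tm ^+ 2) + m.+2%:R * (K * Tm ^+ 2))).
  apply: lerD.
    by rewrite ler_wpM2r ?natrS_div_le2// mulr_ge0// sqr_ge0.
  rewrite -mulrA ler_wpM2l// mulrCA ler_wpM2l// expr2.
  by rewrite ler_pM// tail_ge0.
rewrite -mulrDl mulrA -natrD /K /crude_const -natrM.
by rewrite [in leRHS]factS addnC addn2.
Qed.

Lemma second_moment_bounded a b m s : (m <= n)%N -> 2^-1 <= a < 1 ->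
  (second_moment f n a b m s <= (crude_const m)%:E)%E.
Proof.
case: m => [_ _|m mn a1].
  apply: (@le_trans _ _ 1%E); last by rewrite lee_fin crude_const_ge1.
  by rewrite /second_moment/= lee_fin above_le1.
have [sb|bs] := leP s b; last first.
  by apply: (le_trans (second_moment_above _ _ f_pos _ _ _ _ _ _)) => //;
    rewrite lee_fin crude_const_ge1.
apply: (le_trans (second_moment_crude _ _ _ _ _ _ _)) => //.
by rewrite lee_fin ler_piMr ?crude_const_ge0// exprn_ile1 ?tail_ge0 ?tail_le1.
Qed.

End crude_bound.

Section sharp_bound.
Context {R : realType} (f : density R) (n : nat) (a : R -> R).
Local Notation leb := (@lebesgue_measure R).
Local Notation F := (tail f).
Local Notation K := (@crude_const R).

Hypothesis f_pos : (\int[leb]_(x in `]-oo, 0%R]) (f x)%:E = 0)%E.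
Hypothesis tail_gt0 : forall t, 0 < tail f t.
Hypothesis tail_iv : forall e : R, 0 < e -> exists2 r, 0 < r < 1 &
  \forall u \near +oo, F (r * u) <= (1 + e) * F u.
Hypothesis a_lt1 : \forall b \near +oo, a b < 1.
Hypothesis a_cvg1 : forall r : R, r < 1 -> \forall b \near +oo, r <= a b.
Hypothesis small_jump : forall k r e : R, 0 < k -> 0 < r -> 0 < e ->
  \forall b \near +oo, F (k * b) * F ((1 - a b) ^+ n.-1 * (r * b)) ^+ 2 <=
    e * F b ^+ 2.

Let mD b m s := measurable_second_momentD f n (a b) b m s.

Let ge0 b m s := second_moment_ge0 f n (a b) b m s.

(** The final estimate of the induction, with [T], [Tr], [Tb] the tails at [a * (b - s)], [b - s]
    and [b]. The leading terms add up to [(m + 1) / m * m ^ 2 + (m + 1) = (m + 1) ^ 2]; everything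
    else is of order [y]. *)
Let sharp_arith (m e y T Tr Tb k : R) : 1 <= m -> 0 <= k -> 0 < y <= 1 ->
  0 <= Tr <= T -> 0 <= Tb -> T <= (1 + y) * Tr -> Tr <= (1 + y) * Tb ->
  y * (3 + (m + 1) * (7 + 8 * k)) <= e ->
  (m + 1) / m * ((m ^+ 2 + y) * Tb ^+ 2) + y * Tb ^+ 2 +
    (m + 1) * T * (k * (T - Tr) + Tr) <= ((m + 1) ^+ 2 + e) * Tb ^+ 2.
Proof.
move=> m1 k0 /andP[y0 y1] /andP[Tr0 TrT] Tb0 TT TrTb ye.
have m0 : 0 < m by lra.
have h1 : (m + 1) / m * (m ^+ 2 + y) <= (m + 1) * m + 2 * y.
  rewrite mulrDr -mulrA expr2 mulKf ?gt_eqF//; apply: lerD => //.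
  by rewrite ler_wpM2r ?(ltW y0)// ler_pdivrMr//; lra.
have h2 : T * (k * (T - Tr) + Tr) <=
    (1 + y) * Tr * ((k * y + 1) * Tr).
  apply: ler_pM => //; first lra.
    by rewrite addr_ge0// mulr_ge0//; lra.
  rewrite mulrDl mul1r lerD2r -mulrA ler_wpM2l//; lra.
have h3 : Tr ^+ 2 <= (1 + y) ^+ 2 * Tb ^+ 2.
  by rewrite -exprMn lerXn2r ?nnegrE// mulr_ge0//; lra.
(* The constant [7 + 8 * k] arises from [(1 + y) ^ 3 <= 1 + 7 * y] and [y * (k * y) <= k * y], both
   valid for [y <= 1]. *)
have h4 : (1 + y) ^+ 3 * (1 + k * y) <= 1 + (7 + 8 * k) * y.
  have y31 : (1 + y) ^+ 3 <= 1 + 7 * y.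
    have -> : (1 + y) ^+ 3 = 1 + 3 * y + 3 * (y * y) + y * y * y by ring.
    have yy : y * y <= y by rewrite ler_piMr// ltW.
    have yyy : y * y * y <= y by rewrite (le_trans _ yy)// ler_piMr// mulr_ge0// ltW.
    lra.
  have ky0 : 0 <= k * y by rewrite mulr_ge0// ltW.
  apply: (@le_trans _ _ ((1 + 7 * y) * (1 + k * y))).
    by rewrite ler_wpM2r// addr_ge0.
  have : y * (k * y) <= 1 * (k * y) by rewrite ler_wpM2r.
  lra.
have h5 : T * (k * (T - Tr) + Tr) <= (1 + (7 + 8 * k) * y) * Tb ^+ 2.
  apply: (le_trans h2).
  have -> : (1 + y) * Tr * ((k * y + 1) * Tr) =
    (1 + y) * (1 + k * y) * Tr ^+ 2 by ring.
  apply: (@le_trans _ _ ((1 + y) * (1 + k * y) * ((1 + y) ^+ 2 * Tb ^+ 2))).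
    by rewrite ler_wpM2l// !mulr_ge0// addr_ge0 ?mulr_ge0// ltW.
  have -> : (1 + y) * (1 + k * y) * ((1 + y) ^+ 2 * Tb ^+ 2) =
    (1 + y) ^+ 3 * (1 + k * y) * Tb ^+ 2 by ring.
  by rewrite ler_wpM2r// sqr_ge0.
have Tb20 : 0 <= Tb ^+ 2 by exact: sqr_ge0.
apply: (@le_trans _ _ (((m + 1) * m + 2 * y + y +
    (m + 1) * (1 + (7 + 8 * k) * y)) * Tb ^+ 2)); last first.
  rewrite ler_wpM2r//; lra.
have e1 : (m + 1) / m * ((m ^+ 2 + y) * Tb ^+ 2) <=
    ((m + 1) * m + 2 * y) * Tb ^+ 2 by rewrite mulrA ler_wpM2r.
have e2 : (m + 1) * T * (k * (T - Tr) + Tr) <=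
    (m + 1) * ((1 + (7 + 8 * k) * y) * Tb ^+ 2).
  by rewrite -mulrA ler_wpM2l//; lra.
apply: (le_trans (lerD (lerD e1 (lexx (y * Tb ^+ 2))) e2)).
by rewrite le_eqVlt; apply/orP; left; apply/eqP; ring.
Qed.

(** Uniformity in [s] is what the induction consumes: the bound for fewer steps is applied at every
    [s + x] reached by a small step. Such steps use up part of the distance, so [r] moves closer to
    1 at each stage. *)
Lemma second_moment_sharp m : (0 < m <= n)%N -> forall e : R, 0 < e ->
  exists2 r, 0 < r < 1 & \forall b \near +oo, forall s, r * b <= b - s ->
    (second_moment f n (a b) b m s <= ((m%:R ^+ 2 + e) * F b ^+ 2)%:E)%E.
Proof.
case: m => // m; elim: m => [|m ih] mn e e0.
  (* For [y <= 1], [(1 + y) ^ 2 <= 1 + 3 * y <= 1 + e]. *)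
  pose y := Num.min 1 (e / 3).
  have y0 : 0 < y by rewrite lt_min ltr01 divr_gt0.
  have [r /andP[r0 r1] rF] := tail_iv _ y0.
  exists r; first exact/andP.
  near=> b => s rb.
  have b0 : 0 < b by near: b; exact: nbhs_pinfty_gt.
  have sb : s <= b by rewrite -subr_ge0 (le_trans _ rb)// mulr_ge0// ltW.
  apply: (le_trans (second_moment1 _ _ _ _ _ _ _)) => //.
  rewrite lee_fin expr1n.
  have Fle : F (b - s) <= (1 + y) * F b.
    apply: (le_trans (le_tail _ _ _ rb)); near: b; exact: rF.
  apply: (@le_trans _ _ (((1 + y) * F b) ^+ 2)).
    by rewrite lerXn2r ?nnegrE ?tail_ge0// mulr_ge0 ?tail_ge0// addr_ge0// ltW.
  rewrite exprMn ler_wpM2r ?sqr_ge0//.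
  have y1 : y <= 1 by rewrite ge_min lexx.
  have y3 : y <= e / 3 by rewrite ge_min lexx orbT.
  have yy : y * y <= y by rewrite ler_piMr// ltW.
  have -> : (1 + y) ^+ 2 = 1 + 2 * y + y * y by ring.
  lra.
have mn' : (m < n)%N by exact: ltnW.
have mn1 : (m.+1 <= n.-1)%N by rewrite -ltnS prednK// (leq_trans _ mn).
set k := K m.+1; have k0 : 0 <= k by exact: crude_const_ge0.
have k_gt0 : 0 < k by exact: lt_le_trans (crude_const_ge1 _).
(* The factor of [y] in the error term of [sharp_arith], at [m.+1]. *)
pose c : R := 3 + (m.+1%:R + 1) * (7 + 8 * k).
have c0 : 0 < c by rewrite addr_gt0// mulr_gt0// ?addr_gt0// mulr_gt0.
pose y := Num.min 1 (e / c).
have y0 : 0 < y by rewrite lt_min ltr01 divr_gt0.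
have y1 : y <= 1 by rewrite ge_min lexx.
have yc : y * c <= e by rewrite -ler_pdivlMr// ge_min lexx orbT.
have [r1 /andP[r10 r11] Wr1] := ih mn' _ y0.
have [r2 /andP[r20 r21] Fr2] := tail_iv _ y0.
(* The second entry ensures [r * r >= r1]: a start with [b - s >= r * b] followed by a step of at
   most [(1 - r) * (b - s)] leaves a distance of at least [r * r * b], where the induction
   hypothesis applies. The first entry keeps the tail comparison [Fr2]. *)
pose r := Num.max r2 ((1 + r1) / 2).
have rr2 : r2 <= r by rewrite le_max lexx.
have rr1 : (1 + r1) / 2 <= r by rewrite le_max lexx orbT.
have r_gt0 : 0 < r by exact: lt_le_trans rr2.
have r_lt1 : r < 1 by rewrite gt_max r21/=; lra.
have rr : r1 <= r * r.
  apply: (@le_trans _ _ ((1 + r1) / 2 * ((1 + r1) / 2))).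
    by have := sqr_ge0 (1 - r1); rewrite expr2; lra.
  by apply: ler_pM => //; lra.
exists r; first exact/andP.
(* An explicit threshold is extracted because the comparison is also used at [b - s], where [s] is
   only introduced after [b]. *)
have [u0 [_ Fu]] : \forall u \near +oo, F (r2 * u) <= (1 + y) * F u by exact: Fr2.
have Fr u : 0 < u -> u0 < u -> F (r * u) <= (1 + y) * F u.
  move=> u_gt0 /Fu; apply: le_trans; apply: le_tail.
  by rewrite ler_wpM2r// ltW.
near=> b => s rb.
have b0 : 0 < b by near: b; exact: nbhs_pinfty_gt.
have ab1 : a b < 1 by near: b; exact: a_lt1.
have rab : r <= a b by near: b; exact: a_cvg1.
have ab2 : 2^-1 <= a b by lra.
have ab : 2^-1 <= a b < 1 by rewrite ab2.
have bs_gt0 : 0 < b - s by apply: lt_le_trans rb; rewrite mulr_gt0.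
have sb : s <= b by rewrite -subr_ge0 ltW.
have u0b : u0 < r * b.
  by rewrite mulrC -ltr_pdivrMr//; near: b; exact: nbhs_pinfty_gt (num_real _).
(* The step sizes are cut at [q], [t] and [b - s], and [I1] to [I4] treat the four ranges. Since [r]
   and [a b] are at least 1/2, [q <= t]. *)
set t := a b * (b - s); set q := (1 - r) * (b - s).
have qt : q <= t by rewrite ler_wpM2r ?(ltW bs_gt0)//; lra.
have trs : t <= b - s by rewrite ler_piMl ?(ltW bs_gt0)// ltW.
have TE : F t <= (1 + y) * F (b - s).
  apply: (@le_trans _ _ (F (r * (b - s)))).
    by apply: le_tail; rewrite ler_wpM2r// ltW.
  by apply: Fr => //; exact: lt_le_trans rb.
have TrE : F (b - s) <= (1 + y) * F b.
  apply: (@le_trans _ _ (F (r * b))); first exact: le_tail.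
  apply: Fr => //; apply: (lt_trans u0b); rewrite gtr_pMl//.
have Wb x : (second_moment f n (a b) b m.+1 x <= k%:E)%E.
  by apply: second_moment_bounded.
have I1 : (\int[leb]_(x in `]-oo, q]) ((f x)%:E *
    second_moment f n (a b) b m.+1 (s + x)%R) <=
    ((m.+1%:R ^+ 2 + y) * F b ^+ 2)%:E)%E.
  apply: integral_dens_le1 => //.
  - by rewrite lee_fin mulr_ge0 ?sqr_ge0// addr_ge0 ?sqr_ge0// ltW.
  move=> x /=; rewrite in_itv/= => xq.
  have : r1 * b <= b - (s + x).
    apply: (@le_trans _ _ (r * r * b)); first by rewrite ler_wpM2r// ltW.
    apply: (@le_trans _ _ (r * (b - s))); first by rewrite -mulrA ler_wpM2l// ltW.
    by rewrite /q in xq; lra.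
  by move: (s + x); near: b; exact: Wr1.
(* This range is allotted [y / 2] because [second_moment_step] multiplies it by [m.+2 / m.+1], which
   is at most 2. *)
have I2 : (\int[leb]_(x in `]q, t]) ((f x)%:E *
    second_moment f n (a b) b m.+1 (s + x)%R) <=
    (y / 2 * F b ^+ 2)%:E)%E.
  set V := F ((1 - a b) ^+ n.-1 * (r * b)).
  have V0 : 0 <= V by exact: tail_ge0.
  apply: (@le_trans _ _ ((k * V ^+ 2)%:E * (F ((1 - r) * r * b))%:E)%E); last first.
    rewrite -EFinM lee_fin.
    have hV : F ((1 - r) * r * b) * V ^+ 2 <= (y / (2 * k)) * F b ^+ 2.
      rewrite /V; near: b; apply: small_jump => //.
      + by rewrite mulr_gt0// subr_gt0.
      + by rewrite divr_gt0// mulr_gt0.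
    have -> : k * V ^+ 2 * F ((1 - r) * r * b) =
      k * (F ((1 - r) * r * b) * V ^+ 2) by ring.
    apply: (le_trans (ler_wpM2l k0 hV)).
    rewrite le_eqVlt; apply/orP; left; apply/eqP.
    by field; rewrite gt_eqF.
  apply: (@le_trans _ _ ((k * V ^+ 2)%:E * (F q - F t)%:E)%E); last first.
    rewrite lee_wpmul2l ?lee_fin ?mulr_ge0 ?sqr_ge0//.
    apply: (@le_trans _ _ (F q)); first by rewrite gerBl tail_ge0.
    by apply: le_tail; rewrite -mulrA ler_wpM2l// subr_ge0 ltW.
  rewrite -tail_itv//; apply: integral_dens_le => //.
  - by rewrite lee_fin mulr_ge0// sqr_ge0.
  move=> x /=; rewrite in_itv/= => /andP[_ xt].
  have a'0 : 0 <= 1 - a b by rewrite subr_ge0 ltW.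
  have xr : (1 - a b) * (b - s) <= b - (s + x) by rewrite /t in xt; lra.
  have sxb : s + x <= b.
    by rewrite -subr_ge0; apply: le_trans xr; rewrite mulr_ge0// ltW.
  apply: (le_trans (second_moment_crude _ _ f_pos tail_gt0 _ _ _ _ _ _ _)) => //.
  rewrite lee_fin ler_wpM2l// lerXn2r ?nnegrE ?tail_ge0//.
  (* The crude bound at [s + x] carries the power [m] of [1 - a b], and the present step adds one
     more factor. Since [m + 1 <= n - 1], the power [n - 1] is smaller still. *)
  apply: le_tail; apply: (@le_trans _ _ ((1 - a b) ^+ m * ((1 - a b) * (b - s)))).
    rewrite mulrA -exprSr; apply: ler_pM => //.
    + exact: exprn_ge0.
    + by rewrite mulr_ge0// ltW.
    + by apply: ler_wiXn2l => //; lra.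
  by rewrite ler_wpM2l// exprn_ge0.
have I3 : (\int[leb]_(x in `]t, (b - s)%R]) ((f x)%:E *
    second_moment f n (a b) b m.+1 (s + x)%R) <=
    (k * (F t - F (b - s)))%:E)%E.
  by rewrite EFinM -tail_itv//; apply: integral_dens_le.
have I4 : (\int[leb]_(x in `](b - s)%R, +oo[) ((f x)%:E *
    second_moment f n (a b) b m.+1 (s + x)%R) <= (F (b - s))%:E)%E.
  rewrite tailK -[leRHS]mul1e; apply: integral_dens_le => //.
  move=> x /=; rewrite in_itv/= andbT => bsx.
  by apply: second_moment_above => //; rewrite -ltrBlDl.
apply: (le_trans (second_moment_step _ _ tail_gt0 _ _ _ _ _ _)) => //; rewrite -/t.
have mh : measurable_fun setT (fun x =>
    (f x)%:E * second_moment f n (a b) b m.+1 (s + x)%R)%E.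
  by apply: measurable_dens_mul; exact: mD.
have h0 x : (0 <= (f x)%:E * second_moment f n (a b) b m.+1 (s + x)%R)%E.
  by rewrite mule_ge0 ?densE_ge0 ?ge0.
rewrite (@ge0_integral_itv_split _ -oo%O (BRight q) (BRight t))//.
rewrite (@ge0_integral_itv_split _ (BRight t) (BRight (b - s)) +oo%O)//.
have cm : 0 <= m.+2%:R / m.+1%:R :> R by rewrite divr_ge0.
apply: (le_trans
  (leeD (lee_wpmul2l _ (leeD I1 I2)) (lee_wpmul2l _ (leeD I3 I4)))) => //.
  by rewrite lee_fin mulr_ge0// tail_ge0.
rewrite -!EFinD lee_fin.
rewrite -(natr1 m.+1).
apply: le_trans
  (sharp_arith m.+1%:R e y (F t) (F (b - s)) (F b) k _ _ _ _ _ _ _ _) => //.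
- rewrite lerD2r mulrDr lerD2l mulrA ler_wpM2r ?sqr_ge0//.
  rewrite natr1 mulrA ler_pdivrMr// mulrC.
  by rewrite ler_wpM2l ?(ltW y0)// natrS_div_le2.
- by rewrite ler1n.
- by rewrite y0.
- by rewrite tail_ge0 le_tail.
- by rewrite tail_ge0.
Unshelve. all: by end_near. Qed.

End sharp_bound.

(** * Regular variation of the tail *)

Lemma near_pinftyP (R : realType) (Q : R -> Prop) :
  (\forall u \near +oo, Q u) -> exists2 u0, 1 < u0 & forall u, u0 <= u -> Q u.
Proof.
move=> [M [_ MQ]]; exists (Num.max 2 (M + 1)); first by rewrite lt_max ltr1n.
by move=> u; rewrite ge_max => /andP[_ Mu]; apply: MQ; lra.
Qed.

Lemma powR_ge_near (R : realType) (p M : R) : 0 < p ->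
  \forall b \near +oo, M <= b `^ p.
Proof.
move=> p0; near=> b.
have M1 : M <= Num.max 1 M by rewrite le_max lexx orbT.
apply: (le_trans M1).
have max0 : 0 <= Num.max 1 M by rewrite le_max ler01.
have -> : Num.max 1 M = (Num.max 1 M `^ p^-1) `^ p.
  by rewrite -powRrM mulVf ?gt_eqF// powRr1.
by apply: (ge0_ler_powR (ltW p0)); rewrite ?nnegrE ?powR_ge0//; near: b;
  exact: nbhs_pinfty_ge (num_real _).
Unshelve. all: by end_near. Qed.

Lemma powRN_le_near (R : realType) (p e : R) : 0 < p -> 0 < e ->
  \forall b \near +oo, b `^ (- p) <= e.
Proof.
move=> p0 e0; near=> b.
have b0 : 0 < b by near: b; exact: nbhs_pinfty_gt.
rewrite powRN -[e]invrK lef_pV2 ?posrE ?powR_gt0 ?invr_gt0//.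
by near: b; exact: powR_ge_near.
Unshelve. all: by end_near. Qed.

(** Halving finitely often brings any [u >= u0] into the base interval. This upgrades an eventual
    comparison of the tail at [2 * u] and at [u] to a power bound. *)
Lemma doubling_ind (R : realType) (u0 : R) (Q : R -> Prop) : 0 < u0 ->
  (forall u, u0 <= u <= 2 * u0 -> Q u) ->
  (forall u, u0 <= u -> Q u -> Q (2 * u)) ->
  forall u, u0 <= u -> Q u.
Proof.
move=> u00 base step u u0u.
suff H k : u <= 2 ^+ k * u0 -> Q u.
  have [k uk] : exists k, u / u0 <= 2 ^+ k.
    exists (Num.trunc (u / u0)).+1; apply: (@le_trans _ _ (Num.trunc (u / u0)).+1%:R).
      exact/ltW/truncnS_gt.
    by rewrite -natrX ler_nat ltnW// ltn_expl.
  by apply: (H k); rewrite -ler_pdivrMr.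
elim: k u u0u => [|k ih] u u0u uk.
  by apply: base; rewrite u0u (le_trans uk)// expr0 mul1r; lra.
have [u2|u2] := leP u (2 * u0); first by apply: base; rewrite u0u.
have -> : u = 2 * (u / 2) by field.
have u2' : u0 <= u / 2 by lra.
by apply: step => //; apply: ih => //; rewrite exprS -mulrA in uk; lra.
Qed.

Section regularly_varying_tail.
Context {R : realType} (f : density R) (alpha : R).
Local Notation leb := (@lebesgue_measure R).
Local Notation F := (tail f).
Hypothesis alpha_gt0 : 0 < alpha.
Hypothesis fRV : regularly_varying f (- alpha - 1).

(** Regular variation at [x = 1] says that [f u / f u] tends to 1. As [0 / 0 = 0], this forces [f u]
    to be nonzero eventually. *)
Let dens_gt0_near : \forall u \near +oo, 0 < f u.
Proof.
have h := fRV 1 ltr01; rewrite powR1 in h.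
have : \forall u \near +oo, 0 < f (u * 1) / f u by exact: cvgr_gt h _ ltr01.
apply: filterS => u; rewrite mulr1.
have [->|fu0 _] := eqVneq (f u) 0; first by rewrite mul0r ltxx.
by rewrite lt0r fu0 dens_ge0.
Qed.

(** Otherwise an eventually positive density would vanish almost everywhere on a half-line, which
    has infinite measure. *)
Lemma tail_gt0 t : 0 < F t.
Proof.
rewrite lt0r tail_ge0 andbT; apply/eqP => Ft0.
have [u0 _ fu0] := near_pinftyP _ _ dens_gt0_near.
pose u := Num.max t u0.
have Fu : (\int[leb]_(x in `]u, +oo[) `|(f x)%:E| = 0)%E.
  under eq_integral do rewrite gee0_abs ?densE_ge0//.
  rewrite -tailK; congr EFin; apply/eqP.
  by rewrite eq_le tail_ge0 andbT -Ft0 le_tail// le_max lexx.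
have mf : measurable_fun `]u, +oo[ (EFin \o f).
  by apply: measurable_funTS; exact: measurable_densE.
have [N [mN N0 NE]] := (ae_eq_integral_abs leb (measurable_itv _) mf).1 Fu.
have : (leb `]u, +oo[ <= leb N)%E.
  apply: le_measure; rewrite ?inE//.
  move=> x ux; apply: NE => /= /(_ ux) [] fx0.
  have := fu0 x; rewrite fx0 ltxx => H; have : u0 <= x; last by move/H.
  by move: ux; rewrite /= in_itv/= andbT gt_max => /andP[_ /ltW].
by rewrite N0 lebesgue_measure_itv/= ltry leNgt addye// ltry.
Qed.

Let tail_scale (r t : R) : 0 < r ->
  ((F (r * t))%:E = r%:E * \int[leb]_(y in `]t, +oo[) (f (r * y))%:E)%E.
Proof.
move=> r0; rewrite tailK integral_mkcond (ge0_integral_scale r)//.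
- congr (_ * _)%E; rewrite [RHS]integral_mkcond; apply: eq_integral => x _.
  by rewrite !patchE !mem_setE !in_itv/= !andbT ltr_pM2l.
- apply/(measurable_restrictT _ _).1 => //; apply: measurable_funTS.
  exact: measurable_densE.
- by move=> x; apply: erestrict_ge0 => y _; exact: densE_ge0.
Qed.

Let measurable_dens_scale (r : R) :
  measurable_fun [set: R] (fun y : R => (f (r * y))%:E).
Proof.
apply/measurable_EFinP; apply: (measurableT_comp (measurable_dens f)
  (g := fun y : R => r * y)).
exact: mulrl_measurable.
Qed.

Let powRE (r : R) : 0 < r -> r `^ (- alpha - 1) = r `^ (- alpha) / r.
Proof.
by move=> r0; rewrite powRB ?powRr1 ?(ltW r0)// (gt_eqF r0) implybT.
Qed.

(** Eventually [f (r * y) <= c / r * f y] pointwise; integrating over [y > u] and substituting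
    supplies the factor [r], which turns the index [- alpha - 1] of [f] into [- alpha]. With
    [tail_scale_ge], this is regular variation of the tail. *)
Lemma tail_scale_le (r c : R) : 0 < r -> r `^ (- alpha) < c ->
  \forall u \near +oo, F (r * u) <= c * F u.
Proof.
move=> r0 rc.
have c0 : 0 < c by apply: le_lt_trans rc; exact: powR_ge0.
have fr : r `^ (- alpha - 1) < c / r.
  by rewrite powRE// ltr_pM2r ?invr_gt0.
have h : \forall u \near +oo, f (u * r) / f u < c / r.
  exact: cvgr_lt (fRV r r0) _ fr.
have [u0 _ fu0] := near_pinftyP _ _ (filterI dens_gt0_near h).
near=> u.
have u0u : u0 <= u by near: u; exact: nbhs_pinfty_ge (num_real _).
rewrite -lee_fin tail_scale// EFinM tailK.
apply: (@le_trans _ _ (r%:E * \int[leb]_(y in `]u, +oo[) ((c / r)%:E * (f y)%:E))%E).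
  rewrite lee_wpmul2l ?lee_fin ?(ltW r0)//; apply: ge0_le_integral => //.
  - by move=> x _; exact: densE_ge0.
  - by apply: measurable_funTS; exact: measurable_dens_scale.
  - apply: measurable_funTS; apply: measurable_funeM; exact: measurable_densE.
  move=> y /=; rewrite in_itv/= andbT => uy.
  have [fy] := fu0 y (le_trans u0u (ltW uy)).
  by rewrite ltr_pdivrMr// -EFinM lee_fin mulrC => /ltW.
rewrite ge0_integralZl//; last 3 first.
- by apply: measurable_funTS; exact: measurable_densE.
- by move=> x _; exact: densE_ge0.
- by rewrite lee_fin divr_ge0// ltW.
by rewrite muleA -EFinM mulrC divfK// gt_eqF.
Unshelve. all: by end_near. Qed.

Lemma tail_scale_ge (r c : R) : 0 < r -> 0 < c -> c < r `^ (- alpha) ->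
  \forall u \near +oo, c * F u <= F (r * u).
Proof.
move=> r0 c0 rc.
have fr : c / r < r `^ (- alpha - 1).
  by rewrite powRE// ltr_pM2r ?invr_gt0.
have h : \forall u \near +oo, c / r < f (u * r) / f u.
  exact: cvgr_gt (fRV r r0) _ fr.
have [u0 _ fu0] := near_pinftyP _ _ (filterI dens_gt0_near h).
near=> u.
have u0u : u0 <= u by near: u; exact: nbhs_pinfty_ge (num_real _).
rewrite -lee_fin tail_scale// EFinM tailK.
apply: (@le_trans _ _ (r%:E * \int[leb]_(y in `]u, +oo[) ((c / r)%:E * (f y)%:E))%E).
  rewrite ge0_integralZl//; last 3 first.
  - by apply: measurable_funTS; exact: measurable_densE.
  - by move=> x _; exact: densE_ge0.
  - by rewrite lee_fin divr_ge0// ltW.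
  by rewrite muleA -EFinM mulrC divfK// gt_eqF.
rewrite lee_wpmul2l ?lee_fin ?(ltW r0)//; apply: ge0_le_integral => //.
- by move=> x _; rewrite mule_ge0 ?densE_ge0// lee_fin divr_ge0// ltW.
- apply: measurable_funTS; apply: measurable_funeM; exact: measurable_densE.
- by apply: measurable_funTS; exact: measurable_dens_scale.
move=> y /=; rewrite in_itv/= andbT => uy.
have [fy] := fu0 y (le_trans u0u (ltW uy)).
by rewrite ltr_pdivlMr// -EFinM lee_fin (mulrC y) => /ltW.
Unshelve. all: by end_near. Qed.

Lemma tail_scale_lt1 (e : R) : 0 < e -> exists2 r, 0 < r < 1 &
  \forall u \near +oo, F (r * u) <= (1 + e) * F u.
Proof.
move=> e0; pose c := 1 + e / 2; have c1 : 1 < c by rewrite /c; lra.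
have c0 : 0 < c by exact: lt_trans c1.
have a0 : alpha != 0 by rewrite gt_eqF.
(* With this [r], the power of [r] with exponent [- alpha] is exactly [c = 1 + e / 2], strictly
   below [1 + e]. *)
exists (c `^ (- alpha^-1)).
  rewrite powR_gt0//= powRN invf_lt1 ?powR_gt0//.
  rewrite -[X in X < _](powRr0 c) /powR (gt_eqF c0) ltr_expR.
  by rewrite mul0r mulr_gt0 ?invr_gt0// ln_gt0.
apply: tail_scale_le; first exact: powR_gt0.
by rewrite -powRrM mulrNN mulVf// powRr1 ?(ltW c0)// /c; lra.
Qed.

(** A Potter-type bound: as [beta < alpha], doubling the argument eventually shrinks the tail at
    least as much as it shrinks the power with exponent [- beta], and [doubling_ind] iterates
    this. *)
Lemma tail_upper beta : 0 < beta < alpha ->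
  exists2 c, 0 < c & \forall u \near +oo, F u <= c * u `^ (- beta).
Proof.
move=> /andP[beta0 ba].
have h2 : (2 : R) `^ (- alpha) < 2 `^ (- beta).
  rewrite /powR pnatr_eq0/= ltr_expR ltr_pM2r ?ltrN2//.
  by rewrite ln_gt0// ltr1n.
have [u0 u01 Fu0] := near_pinftyP _ _ (tail_scale_le _ _ (ltr0n R 2) h2).
have u00 : 0 < u0 by exact: lt_trans u01.
have c0 : 0 < (2 * u0) `^ beta by rewrite powR_gt0// mulr_gt0.
(* With this constant the right-hand side is at least 1 on [[u0, 2 * u0]], hence bounds any tail
   there. *)
exists ((2 * u0) `^ beta) => //.
near=> w.
suff H : forall v, u0 <= v -> F v <= (2 * u0) `^ beta * v `^ (- beta).
  by apply: H; near: w; exact: nbhs_pinfty_ge (num_real _).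
apply: (doubling_ind _ _ _ u00).
  move=> u /andP[u0u u2]; apply: (le_trans (tail_le1 _ _)).
  have u_gt0 : 0 < u by exact: lt_le_trans u0u.
  rewrite powRN ler_pdivlMr ?powR_gt0// mul1r.
  by apply: (ge0_ler_powR (ltW beta0)) => //; rewrite nnegrE ?mulr_ge0// ltW.
move=> u u0u Fu; apply: (le_trans (Fu0 _ u0u)).
have -> : (2 * u) `^ (- beta) = 2 `^ (- beta) * u `^ (- beta).
  by rewrite powRM// ltW// (lt_le_trans u00 u0u).
by rewrite mulrCA ler_wpM2l// powR_ge0.
Unshelve. all: by end_near. Qed.

Lemma tail_lower beta : alpha < beta ->
  exists2 c, 0 < c & \forall u \near +oo, c * u `^ (- beta) <= F u.
Proof.
move=> ab; have beta0 : 0 < beta by exact: lt_trans ab.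
have h2 : (2 : R) `^ (- beta) < 2 `^ (- alpha).
  rewrite /powR pnatr_eq0/= ltr_expR ltr_pM2r ?ltrN2//.
  by rewrite ln_gt0// ltr1n.
have p2 : 0 < (2 : R) `^ (- beta) by rewrite powR_gt0.
have [u0 u01 Fu0] := near_pinftyP _ _ (tail_scale_ge _ _ (ltr0n R 2) p2 h2).
have u00 : 0 < u0 by exact: lt_trans u01.
(* With this constant the left-hand side is at most [F (2 * u0)] on [[u0, 2 * u0]], hence at most
   the tail there. *)
exists (F (2 * u0) * u0 `^ beta).
  by rewrite mulr_gt0 ?tail_gt0// powR_gt0.
near=> w.
suff H : forall v, u0 <= v -> F (2 * u0) * u0 `^ beta * v `^ (- beta) <= F v.
  by apply: H; near: w; exact: nbhs_pinfty_ge (num_real _).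
apply: (doubling_ind _ _ _ u00).
  move=> u /andP[u0u u2].
  have u_gt0 : 0 < u by exact: lt_le_trans u0u.
  apply: (@le_trans _ _ (F (2 * u0))); last exact: le_tail.
  rewrite powRN ler_pdivrMr ?powR_gt0// ler_wpM2l ?tail_ge0//.
  by apply: (ge0_ler_powR (ltW beta0)) => //; rewrite nnegrE ltW.
move=> u u0u Fu; apply: (le_trans _ (Fu0 _ u0u)).
have -> : (2 * u) `^ (- beta) = 2 `^ (- beta) * u `^ (- beta).
  by rewrite powRM// ltW// (lt_le_trans u00 u0u).
by rewrite mulrCA ler_wpM2l// powR_ge0.
Unshelve. all: by end_near. Qed.

(* With h = (n - 1) delta the threshold v satisfies v >= const * b^(1/2 + h),
   so F(v)^2 is of smaller order than F(b). *)
Lemma tail_small_jump (n : nat) (a : R -> R) (delta c1 : R) : (1 < n)%N ->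
  0 < delta < (2 * (n%:R - 1))^-1 -> 0 < c1 ->
  (\forall b \near +oo,
    c1 * b `^ (- (2 * (n%:R - 1))^-1 + delta) <= 1 - a b) ->
  forall k r e : R, 0 < k -> 0 < r -> 0 < e ->
  \forall b \near +oo, F (k * b) * F ((1 - a b) ^+ n.-1 * (r * b)) ^+ 2 <=
    e * F b ^+ 2.
Proof.
move=> n1 /andP[d0 dlt] c10 ca k r e k0 r0 e0.
have nN : n%:R - 1 = n.-1%:R :> R.
  by rewrite -[in LHS](prednK (ltnW n1)) -natr1 addrK.
rewrite nN in dlt ca; set N := n.-1 in nN dlt ca *.
have N0 : 0 < N%:R :> R by rewrite ltr0n /N -ltnS prednK// ltnW.
pose h := delta * N%:R.
have h0 : 0 < h by exact: mulr_gt0.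
have h1 : h < 2^-1.
  by move: dlt; rewrite invfM -ltr_pdivlMr// => /lt_le_trans; apply.
have p0 : alpha * (1 - h / 2) < alpha by rewrite gtr_pMr//; lra.
have q0 : 0 < alpha * (1 - h / 2) < alpha by rewrite p0 mulr_gt0//; lra.
have a2 : alpha < alpha * (1 + h / 2) by rewrite ltr_pMr//; lra.
have [C C0 FC] := tail_upper _ q0.
have [c3 c30 Fc] := tail_lower _ a2.
pose Ck := k `^ (- alpha) + 1; have Ck0 : 0 < Ck by rewrite ltr_wpDl// powR_ge0.
have Fk : \forall b \near +oo, F (k * b) <= Ck * F b.
  by apply: tail_scale_le => //; rewrite ltrDl.
pose c2 := c1 ^+ N * r; have c20 : 0 < c2 by rewrite mulr_gt0// exprn_gt0.
set p := alpha * (1 - h / 2) in p0 q0 FC; set q := alpha * (1 + h / 2) in a2 Fc.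
(* The exponents [p < alpha < q] of the Potter bounds are so close to [alpha] that
   [2 * p * (1 / 2 + h) = q + g] with [g > 0]. The squared tail at [v] therefore beats the lower
   bound of order [b ^ (- q)] on [F b] by [b ^ (- g)]. *)
pose g := alpha * (h - h * h).
have hh : h * h < h * 1 by rewrite ltr_pM2l//; lra.
have g0 : 0 < g by rewrite mulr_gt0//; lra.
have pq : p * (1 + 2 * h) = q + g by rewrite /p /q /g; field.
pose C2 := (C * c2 `^ (- p)) ^+ 2.
have C20 : 0 < C2 by rewrite exprn_gt0// mulr_gt0// powR_gt0.
have [u1 u11 Fu1] := near_pinftyP _ _ FC.
near=> b.
have b0 : 0 < b by near: b; exact: nbhs_pinfty_gt.
pose v := c2 * b `^ (2^-1 + h).
have v0 : 0 < v by rewrite mulr_gt0// powR_gt0.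
have vle : v <= (1 - a b) ^+ N * (r * b).
  have -> : v = (c1 * b `^ (- (2 * N%:R)^-1 + delta)) ^+ N * (r * b).
    rewrite /v exprMn -(powR_mulrn N (powR_ge0 b _)) -powRrM.
    have -> : (- (2 * N%:R)^-1 + delta) * N%:R = - 2^-1 + h.
      by rewrite /h; field; rewrite gt_eqF.
    have -> : 2^-1 + h = - 2^-1 + h + 1 by lra.
    rewrite powRD; last by rewrite (gt_eqF b0) implybT.
    by rewrite powRr1 ?(ltW b0)// /c2; ring.
  have cb : c1 * b `^ (- (2 * N%:R)^-1 + delta) <= 1 - a b by near: b; exact: ca.
  have cb0 : 0 <= c1 * b `^ (- (2 * N%:R)^-1 + delta).
    by rewrite mulr_ge0 ?powR_ge0// ltW.
  apply: ler_wpM2r; first by rewrite mulr_ge0// ltW.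
  by rewrite lerXn2r ?nnegrE// (le_trans cb0).
have u1v : u1 <= v.
  rewrite /v mulrC -ler_pdivrMr//; near: b; apply: powR_ge_near; lra.
have FV : F ((1 - a b) ^+ N * (r * b)) ^+ 2 <= C2 * b `^ (- (q + g)).
  apply: (@le_trans _ _ ((C * v `^ (- p)) ^+ 2)).
    rewrite lerXn2r ?nnegrE ?tail_ge0//.
      by rewrite mulr_ge0 ?powR_ge0// ltW.
    apply: (le_trans (le_tail _ _ _ vle)); exact: Fu1.
  rewrite /v powRM ?powR_ge0 ?(ltW c20)// mulrA exprMn -/C2 -powR_mulrn ?powR_ge0//.
  rewrite -!powRrM -pq ler_wpM2l ?(ltW C20)// le_eqVlt; apply/orP; left.
  by apply/eqP; congr (_ `^ _); field.
apply: (@le_trans _ _ (Ck * F b * (C2 * b `^ (- (q + g))))).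
  apply: ler_pM; [exact: tail_ge0|exact: sqr_ge0| |exact: FV].
  by near: b; exact: Fk.
have gb : b `^ (- g) <= e * c3 / (Ck * C2).
  near: b; apply: powRN_le_near => //.
  by apply: divr_gt0; apply: mulr_gt0.
have Fb : c3 * b `^ (- q) <= F b by near: b; exact: Fc.
rewrite opprD powRD; last by rewrite (gt_eqF b0) implybT.
have e1 : Ck * C2 * b `^ (- q) * b `^ (- g) <= e * (c3 * b `^ (- q)).
  apply: (@le_trans _ _ (Ck * C2 * b `^ (- q) * (e * c3 / (Ck * C2)))).
    by rewrite ler_wpM2l// mulr_ge0 ?powR_ge0// mulr_ge0 ?ltW.
  rewrite le_eqVlt; apply/orP; left; apply/eqP; field.
  by rewrite !gt_eqF.
have e2 : e * (c3 * b `^ (- q)) <= e * F b by rewrite ler_wpM2l// ltW.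
have -> : Ck * F b * (C2 * (b `^ (- q) * b `^ (- g))) =
  F b * (Ck * C2 * b `^ (- q) * b `^ (- g)) by ring.
have -> : e * F b ^+ 2 = F b * (e * F b) by ring.
by rewrite ler_wpM2l ?tail_ge0// (le_trans e1).
Unshelve. all: by end_near. Qed.

End regularly_varying_tail.

Lemma threshold_cvg1 (R : realType) (n : nat) (a : R -> R) (delta c2 : R) :
  delta < (2 * (n%:R - 1))^-1 -> 0 < c2 ->
  (\forall b \near +oo,
    1 - a b <= c2 * b `^ (- (2 * (n%:R - 1))^-1 + delta)) ->
  forall r : R, r < 1 -> \forall b \near +oo, r <= a b.
Proof.
move=> dlt c20 ca r r1; near=> b.
have h1 : 1 - a b <= c2 * b `^ (- ((2 * (n%:R - 1))^-1 - delta)).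
  rewrite (_ : - (_ - delta) = - (2 * (n%:R - 1))^-1 + delta); last by lra.
  by near: b; exact: ca.
have h2 : b `^ (- ((2 * (n%:R - 1))^-1 - delta)) <= (1 - r) / c2.
  near: b; apply: powRN_le_near; first by rewrite subr_gt0.
  by rewrite divr_gt0// subr_gt0.
by move: h2; rewrite ler_pdivlMr// mulrC; lra.
Unshelve. all: by end_near. Qed.


(** * Sums of independent variables *)

Section independent_pair.
Context {d : measure_display} {T : measurableType d} {R : realType}.
Variables (P : probability T R) (S Y : {RV P >-> R}) (E : set T).
Hypothesis mE : measurable E.
Hypothesis indep : forall A B : set R, measurable A -> measurable B ->
  (P (S @^-1` A `&` Y @^-1` B `&` E) =
   P (S @^-1` A) * P (Y @^-1` B) * P E)%E.

Let SY (w : T) : R * R := (S w, Y w).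

Let measurable_SY : measurable_fun setT SY.
Proof. by apply: measurable_fun_pair; exact: measurable_funP. Qed.

Let joint : {measure set (R * R) -> \bar R} :=
  measure_function_pushforward__canonical__measure_function_Measure
    (mrestr P mE) measurable_SY.

(** Lifts independence from rectangles to all planar sets, half-planes in particular. If [P E] is
    nonzero, the law of the pair restricted to [E] and divided by [P E] agrees with the product
    measure on rectangles, hence everywhere; a null [E] makes both sides 0. *)
Lemma joint_law (C : set (R * R)) : measurable C ->
  (P ((fun w => (S w, Y w)) @^-1` C `&` E) =
   (distribution P S \x distribution P Y) C * P E)%E.
Proof.
move=> mC; have [PE0|PE0] := eqVneq (P E) 0%E.
  rewrite PE0 mule0; apply/eqP; rewrite eq_le measure_ge0 andbT -PE0.
  apply: le_measure; rewrite ?inE//; apply: measurableI => //.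
  by rewrite -[X in measurable X]setTI; exact: measurable_SY.
have PEfin : P E \is a fin_num by exact: fin_num_measure.
have PE_gt0 : 0 < fine (P E).
  by rewrite fine_gt0// lt0e PE0 measure_ge0 -ge0_fin_numE ?measure_ge0.
have PEK : (fine (P E))%:E = P E by exact: fineK.
have c0 : 0 <= (fine (P E))^-1 by rewrite invr_ge0 ltW.
pose c : {nonneg R} := NngNum c0.
have cE (r : \bar R) : (((fine (P E))^-1)%:E * (r * P E) = r)%E.
  by rewrite -PEK (muleC r) muleA -EFinM mulVf ?gt_eqF// mul1e.
rewrite (@product_measure_unique _ _ _ _ _ (distribution P S) (distribution P Y)
  (mscale c joint))//.
  rewrite /mscale/= /pushforward /mrestr/=.
  by rewrite muleC muleA -{1}PEK -EFinM divff ?gt_eqF// mul1e.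
move=> A B mA mB.
transitivity
  (((fine (P E))^-1)%:E * P (S @^-1` A `&` Y @^-1` B `&` E))%E => //.
by rewrite indep// cE.
Qed.

End independent_pair.

Section sum_of_independent.
Context {d : measure_display} {T : measurableType d} {R : realType}.
Variables (P : probability T R) (n : nat) (X : 'I_n -> {RV P >-> R}).
Hypothesis indepX : mutually_independent X.

Let sum_upto (S : T -> R) (j : nat) :=
  forall w, S w = \sum_(i < n | (i < j)%N) X i w.

Let event_from (j : nat) (B : 'I_n -> set R) : set T :=
  \bigcap_(i in [set` [set i : 'I_n | (j <= i)%N]%SET]) (X i @^-1` B i).

Let measurable_event j B : (forall i, measurable (B i)) ->
  measurable (event_from j B).
Proof.
move=> mB; apply: fin_bigcap_measurable; first exact: finite_finset.
move=> i _; rewrite -[X in measurable X]setTI; exact: measurable_funP.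
Qed.

Let event_fromE (j : 'I_n) B :
  event_from j B = X j @^-1` B j `&` event_from j.+1 B.
Proof.
apply/seteqP; split => w.
  move=> H; split; first by apply: H; rewrite /= inE.
  by move=> i /=; rewrite inE => ji; apply: H; rewrite /= inE ltnW.
move=> [Hj H] i /=; rewrite inE leq_eqVlt => /orP[/eqP ji|ji].
  by rewrite (_ : i = j)//; exact/val_inj.
by apply: H; rewrite /= inE.
Qed.

(** In the induction [joint_law] is applied to the pair [(S, X j)] with [E] an event of the later
    variables, and the preimage of [A] under addition is a planar set. The sum is given
    existentially so that it comes as a random variable. *)
Lemma partial_sum_independent (j : nat) : (j <= n)%N ->
  exists2 S : {RV P >-> R}, sum_upto S j &
    forall (A : set R) (B : 'I_n -> set R), measurable A ->
      (forall i, measurable (B i)) ->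
      (P (S @^-1` A `&` event_from j B) = P (S @^-1` A) * P (event_from j B))%E.
Proof.
elim: j => [_|j ih jn].
  exists (cst 0); first by move=> w; rewrite big_pred0.
  move=> A B mA mB; have [A0|A0] := pselect (A 0).
    rewrite (_ : cst 0 @^-1` A = setT); last by apply/seteqP; split.
    by rewrite setTI probability_setT mul1e.
  rewrite (_ : cst 0 @^-1` A = set0); last by apply/seteqP; split.
  by rewrite set0I measure0 mul0e.
have [S SE Sindep] := ih (ltnW jn).
pose j' := Ordinal jn.
exists (S \+ X j').
  move=> w; rewrite /= SE [RHS](bigD1 j')//= addrC; congr (_ + _).
  by apply: eq_bigl => i; rewrite ltnS ltn_neqAle andbC.
have probE B : (forall i, measurable (B i)) ->
    P (event_from j B) = (P (X j' @^-1` B j') * P (event_from j.+1 B))%E.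
  move=> mB; rewrite /event_from !indepX//.
  rewrite (bigD1 j')/=; last by rewrite inE.
  congr (_ * _)%E; apply: eq_bigl => i; rewrite !inE [RHS]ltn_neqAle andbC.
  by congr (_ && _); rewrite eq_sym.
have pair B C : (forall i, measurable (B i)) -> measurable C ->
    (P ((fun w => (S w, X j' w)) @^-1` C `&` event_from j.+1 B) =
     (distribution P S \x distribution P (X j')) C * P (event_from j.+1 B))%E.
  move=> mB mC; apply: joint_law => //; first exact: measurable_event.
  move=> A B0 mA mB0.
  (* The event in the induction hypothesis still constrains [X j']; prescribing [B0] there yields
     the factorization into three. *)
  pose B' i := if i == j' then B0 else B i.
  have mB' i : measurable (B' i) by rewrite /B'; case: ifP.
  have B'E : event_from j.+1 B' = event_from j.+1 B.
    apply/seteqP; split => w H i /[dup] ij /H; rewrite /B' ifF//;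
      by apply/negbTE; move: ij; rewrite /= inE; apply: contraTneq => ->; rewrite ltnn.
  have := Sindep A B' mA mB'.
  by rewrite probE// (event_fromE j') B'E /B' eqxx setIA muleA.
have pairT C : measurable C ->
    (P ((fun w => (S w, X j' w)) @^-1` C) =
     (distribution P S \x distribution P (X j')) C)%E.
  move=> mC; have := pair (fun=> setT) C (fun=> measurableT) mC.
  rewrite (_ : event_from _ _ = setT) ?setIT ?probability_setT ?mule1//.
  by apply/seteqP; split.
move=> A B mA mB.
have mC : measurable ((fun z : R * R => z.1 + z.2) @^-1` A).
  rewrite -[X in measurable X]setTI.
  by apply: (measurable_funD measurable_fst measurable_snd).
by have := pair B _ mB mC; rewrite -(pairT _ mC).
Qed.

End sum_of_independent.

(** * The exceedance probability *)

Section exceedance.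
Context {R : realType} (f : density R).
Local Notation leb := (@lebesgue_measure R).

(* The probability that m more steps with density f, started at s, end above b. *)
Definition exceedance (b : R) (m : nat) (s : R) : \bar R :=
  sum_chain (fun _ _ => f) b m 0 s.

Lemma sum_chain_exceedance (b : R) m i s :
  sum_chain (fun _ _ => f) b m i s = exceedance b m s.
Proof.
rewrite /exceedance; move: 0%N => k.
elim: m i k s => //= m ih i k s.
by apply: eq_integral => x _; rewrite (ih _ k.+1).
Qed.

Lemma exceedanceS (b : R) m s : exceedance b m.+1 s =
  (\int[leb]_x ((f x)%:E * exceedance b m (s + x)%R))%E.
Proof.
by rewrite {1}/exceedance/=; apply: eq_integral => x _; rewrite sum_chain_exceedance.
Qed.

Lemma exceedance_ge0 (b : R) m s : (0 <= exceedance b m s)%E.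
Proof. by apply: sum_chain_ge0 => *; exact: dens_ge0. Qed.

Lemma measurable_exceedance (b : R) m : measurable_fun setT (exceedance b m).
Proof.
apply: measurable_sum_chain => *; first exact: dens_ge0.
exact: measurableT_comp (measurable_dens f) _.
Qed.

Lemma measurable_exceedanceD (b : R) m (s : R) :
  measurable_fun [set: R] (fun x : R => exceedance b m (s + x)).
Proof.
apply: (measurableT_comp (measurable_exceedance b m) (g := fun x => s + x)).
exact: measurable_funD.
Qed.

(** Interpolates between the iterated integral, at [j = 0], and the probability, at [j = n]: the
    first [j] steps are random variables, the others are integrated out. Independence and Tonelli
    convert one step at a time. *)
Lemma integral_exceedance d (T : measurableType d) (P : probability T R)
    (n : nat) (X : 'I_n -> {RV P >-> R}) (b : R) (j : nat) :
  mutually_independent X -> (forall i, has_density (X i) f) -> (j <= n)%N ->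
  exceedance b n 0 =
  (\int[P]_w exceedance b (n - j) (\sum_(i < n | (i < j)%N) X i w)%R)%E.
Proof.
move=> indepX densX; elim: j => [_|j ih jn].
  rewrite subn0 (eq_integral (cst (exceedance b n 0))); last first.
    by move=> w _; rewrite big_pred0.
  by rewrite integral_cst// [X in (_ * X)%E](probability_setT P) mule1.
have [S SE Sindep] := partial_sum_independent P n X indepX j (ltnW jn).
pose j' := Ordinal jn.
have mX : measurable_fun setT (fun w => (S w, X j' w)).
  by apply: measurable_fun_pair; exact: measurable_funP.
have pair_indep A B : measurable A -> measurable B ->
    (P (S @^-1` A `&` X j' @^-1` B `&` setT) =
     P (S @^-1` A) * P (X j' @^-1` B) * P setT)%E.
  move=> mA mB; pose B' i := if i == j' then B else setT.
  have mB' i : measurable (B' i) by rewrite /B'; case: ifP.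
  have := Sindep A B' mA mB'.
  rewrite (_ : \bigcap_(i in _) _ = X j' @^-1` B).
    by rewrite setIT probability_setT mule1.
  apply/seteqP; split => w.
    by move=> /(_ j'); rewrite /= inE leqnn /B' eqxx; exact.
  by move=> Bw i _; rewrite /B' /preimage/=; case: ifPn => // /eqP ->.
rewrite ih ?(ltnW jn)// -subnSK//; set m := (n - j.+1)%N.
transitivity (\int[distribution P S]_s exceedance b m.+1 s)%E.
  rewrite ge0_integral_pushforward//.
  - by apply: eq_integral => w _ /=; rewrite SE.
  - exact: measurable_exceedance.
  - by move=> s _; exact: exceedance_ge0.
have mD : measurable_fun setT (fun z : R * R => exceedance b m (z.1 + z.2)).
  apply: (measurableT_comp (measurable_exceedance b m)
    (g := fun z : R * R => z.1 + z.2)).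
  exact: measurable_funD.
transitivity (\int[distribution P S]_s \int[distribution P (X j')]_x
    exceedance b m (s + x)%R)%E.
  apply: eq_integral => s _; rewrite exceedanceS.
  rewrite (ge0_integral_lebesgue_density _ (distribution P (X j')) f)//.
  - exact: measurable_dens.
  - by move=> x; exact: dens_ge0.
  - exact: densX.
  - exact: measurable_exceedanceD.
  - by move=> x; exact: exceedance_ge0.
rewrite -(fubini_tonelli1 (m1 := distribution P S) (m2 := distribution P (X j'))
  (fun z : R * R => exceedance b m (z.1 + z.2)%R))//; last first.
  by move=> z; exact: exceedance_ge0.
transitivity (\int[pushforward P (fun w => (S w, X j' w))]_z
    exceedance b m (z.1 + z.2)%R)%E.
  apply: eq_measure_integral => C mC _.
  have := joint_law P S (X j') setT measurableT pair_indep C mC.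
  by rewrite setIT probability_setT mule1 => /esym.
rewrite ge0_integral_pushforward//; last by move=> z _; exact: exceedance_ge0.
apply: eq_integral => w _ /=; congr exceedance.
rewrite SE [RHS](bigD1 j')//= addrC; congr (_ + _).
by apply: eq_bigl => i; rewrite ltnS ltn_neqAle andbC.
Qed.

Lemma exceedance_probability d (T : measurableType d) (P : probability T R)
    (n : nat) (X : 'I_n -> {RV P >-> R}) (b : R) :
  mutually_independent X -> (forall i, has_density (X i) f) ->
  P [set w | (b < \sum_(i < n) X i w)%R] = exceedance b n 0.
Proof.
move=> indepX densX.
have mS : measurable [set w | (b < \sum_(i < n) X i w)%R].
  rewrite -[X in measurable X]setTI.
  have /(_ measurableT `]b, +oo[%classic) := @measurable_sum _ T R setT _
    (index_enum 'I_n) (fun i => X i : T -> R) (fun i => measurable_funP (X i)).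
  rewrite (_ : _ @^-1` _ = [set w | (b < \sum_(i < n) X i w)%R]); first exact.
  by apply/seteqP; split => w /=; rewrite in_itv/= andbT.
rewrite (integral_exceedance _ _ P n X b n)// subnn.
rewrite -[X in P X]setIT -integral_indic//; apply: eq_integral => w _.
rewrite /exceedance/= /above !indicE; congr ((nat_of_bool _)%:R%:E).
rewrite [in RHS](eq_bigl xpredT); last by move=> i; rewrite ltn_ord.
by apply/idP/idP; rewrite !inE.
Qed.

Hypothesis f_pos : (\int[leb]_(x in `]-oo, 0%R]) (f x)%:E = 0)%E.

Lemma integral_dens_ge (D : set R) (h : R -> \bar R) (c : \bar R) :
  measurable D -> measurable_fun setT h -> (0 <= c)%E ->
  (forall x, D x -> c <= h x)%E ->
  (c * \int[leb]_(x in D) (f x)%:E <= \int[leb]_(x in D) ((f x)%:E * h x))%E.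
Proof.
move=> mD mh c0 ch; rewrite -ge0_integralZl//; last 2 first.
- by apply: measurable_funTS; exact: measurable_densE.
- by move=> x _; exact: densE_ge0.
apply: ge0_le_integral => //.
- by move=> x _; rewrite mule_ge0// densE_ge0.
- by apply: measurable_funTS; apply: measurable_funeM; exact: measurable_densE.
- by apply: measurable_funTS; exact: measurable_dens_mul.
- by move=> x Dx; rewrite muleC lee_wpmul2l ?densE_ge0// ch.
Qed.

Lemma exceedance_above (b s : R) m : b < s -> (1 <= exceedance b m s)%E.
Proof.
elim: m s => [|m ih] s bs; first by rewrite /exceedance/= above1.
rewrite exceedanceS integral_dens_pos//; last 2 first.
- exact: measurable_exceedanceD.
- by move=> x; exact: exceedance_ge0.
rewrite -[leLHS]mule1 -[X in (_ * X <= _)%E](_ : (tail f 0)%:E = 1%E); last first.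
  by rewrite tail0.
rewrite tailK; apply: integral_dens_ge => //; first exact: measurable_exceedanceD.
by move=> x /=; rewrite in_itv/= andbT => x0; apply: ih; rewrite ltr_wpDr// ltW.
Qed.

(* The left-hand side is the probability that one of the m steps exceeds b. *)
Lemma exceedance_ge (b s : R) m : 0 < b -> 0 <= s ->
  ((1 - (1 - tail f b) ^+ m)%:E <= exceedance b m s)%E.
Proof.
move=> b0; elim: m s => [|m ih] s s0; first by rewrite expr0 subrr exceedance_ge0.
rewrite exceedanceS integral_dens_pos//; last 2 first.
- exact: measurable_exceedanceD.
- by move=> x; exact: exceedance_ge0.
rewrite (@ge0_integral_itv_split _ _ (BRight b))//; last 3 first.
- by rewrite bnd_simp ltW.
- by apply: measurable_dens_mul; exact: measurable_exceedanceD.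
- by move=> x; rewrite mule_ge0 ?densE_ge0 ?exceedance_ge0.
set q := tail f b; have q1 : 0 <= 1 - q <= 1.
  by rewrite subr_ge0 tail_le1 gerBl tail_ge0.
have /andP[q10 q11] := q1.
have c0 : 0 <= 1 - (1 - q) ^+ m by rewrite subr_ge0 exprn_ile1.
have I1 : ((1 - (1 - q) ^+ m)%:E * (1 - q)%:E <=
    \int[leb]_(x in `]0%R, b]) ((f x)%:E * exceedance b m (s + x)%R))%E.
  rewrite -(tail0 f f_pos) -tail_itv ?(ltW b0)//; apply: integral_dens_ge => //.
  - exact: measurable_exceedanceD.
  - by rewrite tail0.
  - by move=> x /=; rewrite in_itv/= tail0// => /andP[x0 _];
      apply: ih; rewrite addr_ge0// ltW.
have I2 : (1 * q%:E <=
    \int[leb]_(x in `]b, +oo[) ((f x)%:E * exceedance b m (s + x)%R))%E.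
  rewrite tailK; apply: integral_dens_ge => //; first exact: measurable_exceedanceD.
  move=> x /=; rewrite in_itv/= andbT => bx.
  by apply: exceedance_above; rewrite ltr_wpDl.
apply: (le_trans _ (leeD I1 I2)); rewrite mul1e -EFinM -EFinD lee_fin.
rewrite le_eqVlt; apply/orP; left; apply/eqP; rewrite exprS; ring.
Qed.

Lemma exceedance_le1 (b s : R) m : (exceedance b m s <= 1)%E.
Proof.
elim: m s => [|m ih] s; first by rewrite /exceedance/= lee_fin above_le1.
rewrite exceedanceS; apply: integral_dens_le1 => //.
- exact: measurable_exceedanceD.
- by move=> x; exact: exceedance_ge0.
Qed.

Hypothesis tail_gt0 : forall t, 0 < tail f t.

(** Weighting the sampling density by the ratio gives back [f] unless the density is 0 while [f] is
    not. This happens only at the last step with [x <= b - s], where the final sum does not exceed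
    [b] and the integrand vanishes anyway. *)
Lemma likelihood_ratio_unbiased n (a b : R) m s : (m <= n)%N ->
  sum_chain (fun j s x => cm_density f n a b j s x * cm_ratio1 f n a b j s x ^+ 1)
    b m (n.+1 - m) s = exceedance b m s.
Proof.
elim: m s => [//|m ih] s mn; rewrite exceedanceS /= subSS.
apply: eq_integral => x _; rewrite -subSn ?(ltnW mn)// ih ?(ltnW mn)//.
have [fx0|fx0] := eqVneq (f x) 0.
  by rewrite /cm_ratio1 fx0 mul0r expr0n/= mulr0 !mul0e.
have [k0|k0] := eqVneq (cm_density f n a b (n - m) s x) 0; last first.
  by rewrite /cm_ratio1 expr1 mulrCA divff// mulr1.
rewrite k0 mul0r mul0e; move: k0; rewrite /cm_density.
have f0 : 0 < f x by rewrite lt0r fx0 dens_ge0.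
have [bs|sb] := ltP b s; first by move/eqP; rewrite (negbTE fx0).
case: m mn ih => [|m] mn ih; last first.
  rewrite ltn_subrL/= (leq_ltn_trans _ mn)// => /eqP.
  rewrite gt_eqF// ltr_wpDr//.
    by rewrite mulr_ge0 ?mix_q_ge0 ?cond_tail_density_ge0.
  rewrite mulr_gt0// /mix_p divr_gt0 ?ltr0n ?addn1// subKn ?(ltnW mn)//.
rewrite subn0 ltnn /cond_tail_density; case: ltP => [_ /eqP|xbs _].
  by rewrite gt_eqF// divr_gt0.
rewrite /exceedance/= above0 ?mule0//; lra.
Qed.

End exceedance.

(** * Relative error *)

Section estimator.
Context {R : realType} (f : density R) (n : nat).
Local Notation leb := (@lebesgue_measure R).

(** The exponent is positive because the indicator has to survive: a zeroth power would turn it into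
    1. *)
Lemma cm_estimatorX (a b : R) (k : nat) (t : n.-tuple R) :
  cm_estimator f a b t ^+ k.+1 =
  path_weight (fun j s x => cm_ratio1 f n a b j s x ^+ k.+1) b n 1 0 t.
Proof.
rewrite /cm_estimator /path_weight exprMn; congr (_ * _).
  by rewrite -prodrXl; apply: eq_bigr => j _; rewrite add0r add1n.
rewrite add0r /above !indicE.
have -> : (t \in [set u | b < partial_sum u n]) =
    (partial_sum t n \in [set u | b < u]).
  by apply/idP/idP; rewrite !inE.
by case: (_ \in _); rewrite ?expr1n ?expr0n.
Qed.

Lemma integral_cm_estimatorX (a b : R) (k : nat) :
  (\int[cm_law f n a b]_t (cm_estimator f a b t ^+ k.+1)%:E =
   sum_chain (fun j s x => (cm_density f n a b j s x *
     cm_ratio1 f n a b j s x ^+ k.+1)%R) b n 1 0)%E.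
Proof.
rewrite -integral_cm_tail_kernel.
- by apply: eq_integral => t _; rewrite cm_estimatorX.
- by move=> j s x; rewrite exprn_ge0// cm_ratio1_ge0.
- by move=> j; apply: measurable_funX; exact: measurable_cm_ratio1.
Qed.

Lemma integral_cm_estimator2 (a b : R) :
  (\int[cm_law f n a b]_t (cm_estimator f a b t ^+ 2)%:E =
   second_moment f n a b n 0)%E.
Proof. by rewrite integral_cm_estimatorX /second_moment subSnn. Qed.

Hypothesis tail_gt0 : forall t, 0 < tail f t.

Lemma integral_cm_estimator (a b : R) :
  (\int[cm_law f n a b]_t (cm_estimator f a b t)%:E = exceedance f b n 0)%E.
Proof.
rewrite -(likelihood_ratio_unbiased f tail_gt0 n a b n 0)// subSnn.
by rewrite -integral_cm_estimatorX; apply: eq_integral => t _; rewrite expr1.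
Qed.

Lemma cm_estimator_ge0 (a b : R) (t : n.-tuple R) : 0 <= cm_estimator f a b t.
Proof.
rewrite -[leRHS]expr1 cm_estimatorX path_weight_ge0// => j s x.
by rewrite exprn_ge0// cm_ratio1_ge0.
Qed.

Lemma measurable_cm_estimator (a b : R) :
  measurable_fun setT (fun t : n.-tuple R => cm_estimator f a b t).
Proof.
under eq_fun do rewrite -[cm_estimator _ _ _ _]expr1 cm_estimatorX.
apply: measurable_path_weight => j.
by apply: measurable_funX; exact: measurable_cm_ratio1.
Qed.

(* Integrate Z^2 + p^2 >= 2 p Z, where p is the mean of the estimator Z. *)
Lemma second_moment_ge_sqr (a b p : R) : 0 <= p ->
  exceedance f b n 0 = p%:E -> ((p ^+ 2)%:E <= second_moment f n a b n 0)%E.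
Proof.
move=> p0 pE; rewrite -integral_cm_estimator2.
have mZ := measurable_cm_estimator a b.
set mu := cm_law f n a b.
have mZ2 : measurable_fun setT
    (fun t : n.-tuple R => (cm_estimator f a b t ^+ 2)%:E).
  by apply/measurable_EFinP; exact: measurable_funX.
have H : (\int[mu]_t (2 * p * cm_estimator f a b t)%:E <=
    \int[mu]_t ((cm_estimator f a b t ^+ 2)%:E + (p ^+ 2)%:E))%E.
  apply: ge0_le_integral => //.
  - move=> t _; rewrite lee_fin.
    by apply: mulr_ge0; [exact: mulr_ge0|exact: cm_estimator_ge0].
  - by apply/measurable_EFinP; exact: measurable_funM.
  - exact: emeasurable_funD.
  - move=> t _; rewrite -EFinD lee_fin.
    by have := sqr_ge0 (cm_estimator f a b t - p); rewrite sqrrB; lra.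
move: H; rewrite ge0_integralD//; last 2 first.
- by move=> t _; rewrite lee_fin sqr_ge0.
- by move=> t _; rewrite lee_fin sqr_ge0.
rewrite integral_cst// [X in (_ <= _ + _ * X)%E](cm_law_setT _ _ _ tail_gt0) mule1.
have -> : (\int[mu]_t (2 * p * cm_estimator f a b t)%:E = (2 * p * p)%:E)%E.
  rewrite [RHS]EFinM -pE -(integral_cm_estimator a b) -ge0_integralZl//.
  - exact/measurable_EFinP.
  - by move=> t _; rewrite lee_fin cm_estimator_ge0.
  - by rewrite lee_fin mulr_ge0.
rewrite -leeBlDr// -EFinB; apply: le_trans.
by rewrite lee_fin; lra.
Qed.

End estimator.

(** A quantitative form of [1 - (1 - q) ^ n ~ n * q] near 0. Through [exceedance_ge] it bounds the
    exceedance probability below by about [n * tail f b]. *)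
Lemma one_subX_ge (R : realType) (q : R) (n : nat) : 0 <= q <= 1 ->
  n%:R * q * (1 - n%:R * q) <= 1 - (1 - q) ^+ n.
Proof.
move=> /andP[q0 q1]; elim: n => [|n ih]; first by rewrite mul0r mul0r expr0 subrr.
have n0 : 0 <= n%:R :> R by [].
have : (1 - q) * (n%:R * q * (1 - n%:R * q)) <= (1 - q) * (1 - (1 - q) ^+ n).
  by rewrite ler_wpM2l// subr_ge0.
rewrite exprS -natr1.
(* The terms in [h1] and [h2] add up to the slack in the induction step. *)
have h1 : 0 <= n%:R * n%:R * (q * q * q) by rewrite !mulr_ge0.
have h2 : 0 <= (n%:R + 1) * (q * q) by rewrite !mulr_ge0// addr_ge0.
lra.
Qed.

Lemma tail_le_near (R : realType) (f : density R) (alpha e : R) : 0 < alpha ->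
  regularly_varying f (- alpha - 1) -> 0 < e -> \forall b \near +oo, tail f b <= e.
Proof.
move=> alpha0 fRV e0.
have a2 : 0 < alpha / 2 < alpha by lra.
have [c c0 fc] := tail_upper f alpha fRV _ a2.
have /andP[a20 _] := a2.
near=> b; apply: (@le_trans _ _ (c * b `^ (- (alpha / 2)))).
  by near: b; exact: fc.
rewrite mulrC -ler_pdivlMr//; near: b; apply: powRN_le_near => //.
exact: divr_gt0.
Unshelve. all: by end_near. Qed.

Lemma positive_density d (T : measurableType d) (R : realType)
    (P : probability T R) (X : {RV P >-> R}) (f : density R) :
  has_density X f -> P [set w | 0 < X w] = 1%E ->
  (\int[lebesgue_measure]_(x in `]-oo, 0%R]) (f x)%:E = 0)%E.
Proof.
move=> densX posX; rewrite -densX//.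
have mpos : measurable [set w | 0 < X w].
  rewrite (_ : [set w | _] = X @^-1` `]0, +oo[).
    by rewrite -[X in measurable X]setTI; exact: measurable_funP.
  by apply/seteqP; split => w /=; rewrite in_itv/= andbT.
have := probability_setC P mpos; rewrite posX subee// => <-.
congr (P _); apply/seteqP; split => w /=; rewrite in_itv/=.
  by rewrite leNgt => /negP.
by move/negP; rewrite -leNgt.
Qed.

Theorem theorem5p1 (R : realType) (n : nat) (hn : (2 <= n)%N)
    (d : measure_display) (T : measurableType d) (P : probability T R)
    (X : 'I_n -> {RV P >-> R}) (f : density R) (alpha : R)
    (a : R -> R) (delta : R)
    (hindep : mutually_independent X)
    (hdens : forall i, has_density (X i) f)
    (hpos : forall i, P [set w | 0 < X i w] = 1%E)
    (halpha : 0 < alpha)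
    (hRV : regularly_varying f (- alpha - 1))
    (ha : forall b : R, 0 < b -> 0 < a b < 1)
    (hdelta : 0 < delta < (2 * (n%:R - 1))^-1)
    (horder : exists c1 c2 : R, [/\ 0 < c1, c1 <= c2 &
      \forall b \near +oo,
        c1 * b `^ (- (2 * (n%:R - 1))^-1 + delta) <= 1 - a b
          <= c2 * b `^ (- (2 * (n%:R - 1))^-1 + delta)]) :
  ((\int[cm_law f n (a b) b]_t ((cm_estimator f (a b) b t) ^+ 2)%:E)
     / (P [set w | (b < \sum_(i < n) X i w)%R]) ^+ 2)%E
    @[b --> +oo] --> 1%E.
Proof.
have [c1 [c2 [c10 c12 hc]]] := horder.
have /andP[_ dlt] := hdelta.
have n0 : (0 < n)%N by exact: ltnW.
have fpos := positive_density _ _ _ _ _ _ (hdens (Ordinal n0)) (hpos _).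
have Fgt0 := tail_gt0 f alpha hRV.
have alt1 : \forall b \near +oo, a b < 1.
  near=> b; have b0 : 0 < b by near: b; exact: nbhs_pinfty_gt.
  by have /andP[] := ha b b0.
have hc1 : \forall b \near +oo,
    c1 * b `^ (- (2 * (n%:R - 1))^-1 + delta) <= 1 - a b.
  by apply: filterS hc => b /andP[].
have hc2 : \forall b \near +oo,
    1 - a b <= c2 * b `^ (- (2 * (n%:R - 1))^-1 + delta).
  by apply: filterS hc => b /andP[].
have acvg := threshold_cvg1 R n a delta c2 dlt (lt_le_trans c10 c12) hc2.
have small := tail_small_jump f alpha halpha hRV n a delta c1 hn hdelta c10 hc1.
have sharp := second_moment_sharp f n a fpos Fgt0
  (tail_scale_lt1 f alpha halpha hRV) alt1 acvg small n.
have N0 : 0 < n%:R :> R by rewrite ltr0n.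
set ratio := fun b : R => _ : \bar R.
(* The existential records that the extended real ratio is eventually finite, which convergence to
   [1%E] requires besides the estimate. *)
suff key e : 0 < e -> \forall b \near +oo,
    exists2 x, ratio b = x%:E & 1 <= x <= 1 + e.
  apply/fine_cvgP; split.
    by have := key 1 ltr01; apply: filterS => b [x -> _].
  apply/cvgrPdist_le => e e0; have := key e e0; apply: filterS => b [x /= -> x1e].
  by move: x1e => /andP[x1 xe]; rewrite ler_distlC /= xe andbT; lra.
(* Both the upper bound on the second moment and the lower bound on the probability have relative
   error [e1]; this choice gives [1 + e1 <= (1 + e) * (1 - 2 * e1) <= (1 + e) * (1 - e1) ^ 2]. *)
move=> e0; pose e1 := Num.min (1 / 8) (e / 8).
have e10 : 0 < e1 by rewrite lt_min !divr_gt0.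
have e11 : e1 <= 1 / 8 by rewrite ge_min lexx.
have e1e : e1 <= e / 8 by rewrite ge_min lexx orbT.
have nn : (0 < n <= n)%N by rewrite n0 leqnn.
have e20 : 0 < n%:R ^+ 2 * e1 by rewrite mulr_gt0// exprn_gt0.
have [r /andP[r0 r1] Wr] := sharp nn _ e20.
near=> b.
have b0 : 0 < b by near: b; exact: nbhs_pinfty_gt.
have Fb : n%:R * tail f b <= e1.
  rewrite mulrC -ler_pdivlMr//; near: b.
  by apply: (tail_le_near _ _ _ _ halpha hRV); exact: divr_gt0.
have Wb : (second_moment f n (a b) b n 0 <=
    ((n%:R ^+ 2 + n%:R ^+ 2 * e1) * tail f b ^+ 2)%:E)%E.
  have : r * b <= b - 0 by rewrite subr0 ler_piMl// ltW.
  by near: b; apply: filterS Wr => b; apply.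
set q := tail f b in Fb Wb *; have q0 : 0 < q by exact: Fgt0.
have q1 : 0 <= q <= 1 by rewrite tail_ge0 tail_le1.
set m2 := second_moment f n (a b) b n 0 in Wb.
pose p := fine (exceedance f b n 0).
have pE : exceedance f b n 0 = p%:E.
  rewrite /p fineK// ge0_fin_numE ?exceedance_ge0//.
  by rewrite (le_lt_trans (exceedance_le1 _ _ _ _))// ltry.
have p_ge : n%:R * q * (1 - e1) <= p.
  apply: (@le_trans _ _ (1 - (1 - q) ^+ n)).
    apply: le_trans (one_subX_ge _ _ _ q1).
    by rewrite ler_wpM2l ?mulr_ge0 ?(ltW q0)// lerB.
  by rewrite -lee_fin -pE; apply: exceedance_ge.
have nq0 : 0 < n%:R * q by exact: mulr_gt0.
have p0 : 0 < p by apply: lt_le_trans p_ge; rewrite mulr_gt0//; lra.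
have m2_ge : ((p ^+ 2)%:E <= m2)%E.
  by apply: (second_moment_ge_sqr f n Fgt0 (a b) b p (ltW p0)).
pose v := fine m2.
have vE : m2 = v%:E.
  rewrite /v fineK// ge0_fin_numE ?second_moment_ge0//.
  by rewrite (le_lt_trans Wb)// ltry.
exists (v / p ^+ 2).
  rewrite /ratio integral_cm_estimator2 -/m2 vE.
  rewrite (exceedance_probability f _ _ P n X b hindep hdens) pE.
  by rewrite -EFin_expe inver expf_eq0/= (gt_eqF p0) -EFinM.
have p20 : 0 < p ^+ 2 by exact: exprn_gt0.
rewrite ler_pdivlMr// mul1r ler_pdivrMr// -lee_fin -vE m2_ge/=.
move: Wb; rewrite vE lee_fin => /le_trans; apply.
apply: (@le_trans _ _ ((1 + e) * (n%:R * q * (1 - e1)) ^+ 2)); last first.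
  rewrite ler_wpM2l ?addr_ge0 ?(ltW e0)// lerXn2r ?nnegrE ?(ltW p0)//.
  by rewrite mulr_ge0 ?(ltW nq0)//; lra.
have -> : (n%:R ^+ 2 + n%:R ^+ 2 * e1) * q ^+ 2 = (1 + e1) * (n%:R * q) ^+ 2 by ring.
have -> : (1 + e) * (n%:R * q * (1 - e1)) ^+ 2 =
  (1 + e) * (1 - e1) ^+ 2 * (n%:R * q) ^+ 2 by ring.
rewrite ler_wpM2r ?sqr_ge0//.
apply: (@le_trans _ _ ((1 + e) * (1 - 2 * e1))).
  have : e * e1 <= e * (1 / 8) by rewrite ler_wpM2l// ltW.
  lra.
rewrite ler_wpM2l ?addr_ge0 ?(ltW e0)//.
by have := sqr_ge0 e1; rewrite sqrrB expr1n; lra.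
Unshelve. all: by end_near. Qed.
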